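(* Let $\Omega\subset\mathbb{R}^n$ be a bounded domain, $\varepsilon>0$, $\alpha,\beta>0$ with $\alpha+\beta=1$, and let $F:\Gamma_\varepsilon\to\mathbb{R}$ be bounded and Borel. Consider the tug-of-war with noise with payoff $F$, where the strategies allowed to the players are those of one of the following alternatives: (1) the strategies may depend only on the current point $x_k$; (2) the strategies may depend only on the full history of locations $x_0,x_1,\ldots,x_k$; (3) the strategies may depend only on both the full history of locations $x_0,x_1,\ldots,x_k$ and the outcomes $c_1,\ldots,c_k$ of the coin tosses until time $k$. Then, independently of which of the alternatives (1)--(3) for the allowed strategies is used, the value of the game exists, is Borel, and equals the unique bounded Borel function $u:\Omega_\varepsilon\to\mathbb{R}$ satisfying $u=F$ on $\Gamma_\varepsilon$ and $$u(x)=\frac{\alpha}{2}\sup_{B_\varepsilon(x)}u+\frac{\alpha}{2}\inf_{B_\varepsilon(x)}u+\frac{\beta}{|B_\varepsilon(x)|}\int_{B_\varepsilon(x)}u\,dy\qquad\text{for every }x\in\Omega.$$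
   Context: $B_\varepsilon(x)$ is the open ball of radius $\varepsilon$ centred at $x$, $|B_\varepsilon(x)|$ is its Lebesgue measure, $\Gamma_\varepsilon=\{x\in\mathbb{R}^n\setminus\Omega:\operatorname{dist}(x,\Omega)\le\varepsilon\}$ and $\Omega_\varepsilon=\Gamma_\varepsilon\cup\Omega$. Tug-of-war with noise: a token is placed at a starting point $x_0$. When the token is at $x_k\in\Omega$, an outcome $c_{k+1}\in\{0,1,2\}$ is drawn, independently of the past, with probabilities $\alpha/2,\alpha/2,\beta$ respectively. If $c_{k+1}=0$, Player I moves the token to a point $x_{k+1}\in B_\varepsilon(x_k)$ according to his strategy; if $c_{k+1}=1$, Player II moves the token to a point $x_{k+1}\in B_\varepsilon(x_k)$ according to his strategy; if $c_{k+1}=2$, $x_{k+1}$ is chosen according to the uniform probability distribution on $B_\varepsilon(x_k)$. The game stops at the first time $\tau=\min\{k\ge0:x_k\in\Gamma_\varepsilon\}$ (so $\tau=0$ if $x_0\in\Gamma_\varepsilon$), and then Player II pays Player I the amount $F(x_\tau)$. A strategy $S_{\mathrm I}$ of Player I is a collection of Borel measurable functions, one for each step $k\ge0$, giving the next position $x_{k+1}\in B_\varepsilon(x_k)$ (in case Player I wins the toss) as a function of the information available at time $k$ under the alternative in force; a strategy $S_{\mathrm{II}}$ of Player II is defined likewise. A starting point $x_0$ and strategies $S_{\mathrm I},S_{\mathrm{II}}$ determine a probability measure on the space of game sequences; $\mathbb{E}^{x_0}_{S_{\mathrm I},S_{\mathrm{II}}}$ denotes the corresponding expectation. The values for the two players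 are $$u^\varepsilon_{\mathrm I}(x_0)=\sup_{S_{\mathrm I}}\inf_{S_{\mathrm{II}}}\mathbb{E}^{x_0}_{S_{\mathrm I},S_{\mathrm{II}}}[F(x_\tau)],\qquad u^\varepsilon_{\mathrm{II}}(x_0)=\inf_{S_{\mathrm{II}}}\sup_{S_{\mathrm I}}\mathbb{E}^{x_0}_{S_{\mathrm I},S_{\mathrm{II}}}[F(x_\tau)],$$ where suprema and infima are over the strategies of the alternative in force (the same one for both players). The value of the game exists if $u^\varepsilon_{\mathrm I}(x_0)=u^\varepsilon_{\mathrm{II}}(x_0)$ for every starting point $x_0$; the value (function) is then this common function. *)

(* Defs.v *)
From HB Require Import structures.
From mathcomp Require Import all_boot all_order all_algebra.
From mathcomp Require Import all_classical all_reals all_analysis.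
From mathcomp Require Import measurable_realfun.

Set Implicit Arguments.
Unset Strict Implicit.
Unset Printing Implicit Defensive.
Import Order.TTheory GRing.Theory Num.Theory.
Import numFieldNormedType.Exports.
Local Open Scope classical_set_scope.
Local Open Scope ring_scope.

(* Borel sigma-algebra of the (product) topology of matrices. *)
HB.instance Definition _ (R : realType) (m n : nat) :=
  Measurable.copy 'M[R]_(m, n) (g_sigma_algebraType (@open 'M[R]_(m, n))).

HB.instance Definition _ (n : nat) := isPointed.Build 'I_n.+1 ord0.
HB.instance Definition _ (n : nat) :=
  @isMeasurable.Build default_measure_display 'I_n.+1 discrete_measurable
    discrete_measurable0 discrete_measurableC discrete_measurableU.

Lemma open_measurable_mx (R : realType) m n (U : set 'M[R]_(m, n)) :
  open U -> measurable U.
Proof. exact: sub_sigma_algebra. Qed.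

Lemma measurable_fun_rV d (T : measurableType d) (R : realType) n
    (f : T -> 'rV[R]_n) :
  (forall i, measurable_fun setT (fun t => f t 0 i)) -> measurable_fun setT f.
Proof.
move=> mf; apply: (@measurability _ _ _ _ _ _ (@open 'rV[R]_n)) => //.
move=> _ [U oU <-]; rewrite setTI.
pose q v : 'rV[R]_n := map_mx ratr (v : 'rV[rat]_n).
pose P (vk : 'rV[rat]_n * nat) := ball (q vk.1) (vk.2.+1%:R^-1 : R) `<=` U.
have -> : f @^-1` U =
    \bigcup_(vk in P) f @^-1` (ball (q vk.1) (vk.2.+1%:R^-1 : R)).
  apply/seteqP; split => [t Uft|t [vk Pvk /= ?]]; last exact: Pvk.
  have /nbhs_ballP[e /= e0 eU] : nbhs (f t) U by exact: open_nbhs_nbhs.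
  have e20 : 0 < e / 2 by rewrite divr_gt0.
  have [k _ /(_ k (leqnn k)) ke] := near_infty_natSinv_lt (PosNum e20).
  rewrite /= in ke.
  have k0 : 0 < k.+1%:R^-1 :> R by rewrite invr_gt0.
  have /choice[v vP] : forall i, exists r : rat,
      ball (f t 0 i) (k.+1%:R^-1) (ratr r : R).
    move=> i.
    have /(_ _ (ball_open _ _)) := @dense_rat R (ball (f t 0 i) k.+1%:R^-1).
    have fne : ball (f t 0 i) (k.+1%:R^-1 : R) !=set0.
      by exists (f t 0 i); exact: ballxx.
    by move=> /(_ fne)[x [/= fr [r _ rE]]]; exists r; rewrite rE.
  have ftv : ball (f t) (k.+1%:R^-1) (q (\row_i v i)).
    by split => // i j; rewrite !mxE ord1; exact: vP.
  exists (\row_i v i, k) => /=; last exact: ball_sym.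
  move=> y /= vy; apply: eU.
  rewrite -ball_normE/= (le_lt_trans (ler_distD (q (\row_i v i)) _ _))//.
  rewrite [ltRHS]splitr ltrD//.
    by apply: lt_trans ke; rewrite -ball_normE in ftv.
  by apply: lt_trans ke; rewrite -ball_normE in vy.
rewrite bigcup_mkcond; apply: countable_bigcupT_measurable => [|vk].
  exact: countableP.
case: ifPn => // _.
have -> : f @^-1` (ball (q vk.1) (vk.2.+1%:R^-1 : R)) =
    \bigcap_(i in [set: 'I_n])
      ((fun t => f t 0 i) @^-1` ball (q vk.1 0 i) (vk.2.+1%:R^-1 : R)).
  apply/seteqP; split => [t [_ qf] i _|t qf]; first exact: qf.
  by split => [|i j]; [rewrite invr_gt0 | rewrite ord1; exact: qf].
apply: fin_bigcap_measurable => // i _.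
by rewrite -[X in measurable X]setTI; apply: mf => //; exact: measurable_ball.
Qed.

Lemma measurable_coord_rV (R : realType) n (i : 'I_n) :
  measurable_fun setT (fun v : 'rV[R]_n => v 0 i).
Proof.
apply: (measurability _ (RGenOpens.measurableE R)) => _ [_ [a [b ->]] <-].
rewrite setTI; apply: sub_sigma_algebra; apply: open_comp.
  by move=> v _; exact: coord_continuous.
exact: interval_open.
Qed.

Definition rcons_rV (R : realType) n (p : 'rV[R]_n * R) : 'rV[R]_n.+1 :=
  \row_i (if unlift ord_max i is Some j then p.1 0 j else p.2).

Lemma measurable_rcons_rV (R : realType) n :
  measurable_fun setT (@rcons_rV R n).
Proof.
apply: measurable_fun_rV => i; rewrite /rcons_rV.
under eq_fun do rewrite mxE.
case: (unlift ord_max i) => [j|]; last exact: measurable_snd.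
apply: (@measurableT_comp _ _ _ _ _ _ (fun v : 'rV[R]_n => v 0 j)) => //.
exact: measurable_coord_rV.
Qed.

Section lebesgue_rV_step.
Context (R : realType) (n : nat) (mu : {measure set 'rV[R]_n -> \bar R}).

Definition lebesgue_rV_step : set 'rV[R]_n.+1 -> \bar R :=
  pushforward (mu \x lebesgue_measure)%E (@rcons_rV R n).

HB.instance Definition _ := Measure.copy lebesgue_rV_step
  (measure_function_pushforward__canonical__measure_function_Measure
    (mu \x lebesgue_measure)%E (@measurable_rcons_rV R n)).

End lebesgue_rV_step.

(* n-dimensional Lebesgue measure on the Borel sets of R^n, by iterated
   products; R^0 is a point of mass 1. *)
Fixpoint lebesgue_rV (R : realType) (n : nat) :
    {measure set 'rV[R]_n -> \bar R} :=
  match n return {measure set 'rV[R]_n -> \bar R} with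
  | 0 => @dirac _ 'rV[R]_0 0 R
  | m.+1 => lebesgue_rV_step (lebesgue_rV R m)
  end.

Section geometry.
Context {R : realType} {n : nat}.
Implicit Types (x y : 'rV[R]_n) (r eps : R) (Omega : set 'rV[R]_n).

(* The library norm on 'rV[R]_n is the sup norm, hence [enorm] and [eball]. *)
Definition enorm x : R := Num.sqrt (\sum_(i < n) x 0 i ^+ 2).

Definition eball x r : set 'rV[R]_n := [set y | enorm (y - x) < r].

Definition edist_set x Omega : R := inf [set enorm (x - y) | y in Omega].

Definition boundary_strip Omega eps : set 'rV[R]_n :=
  [set x | ~ Omega x /\ edist_set x Omega <= eps].

Definition enlarged Omega eps : set 'rV[R]_n :=
  boundary_strip Omega eps `|` Omega.

Definition domain Omega : Prop :=
  [/\ open Omega, connected Omega & Omega !=set0].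

Definition bounded_on (A : set 'rV[R]_n) (f : 'rV[R]_n -> R) : Prop :=
  exists M : R, forall x, A x -> `|f x| <= M.

End geometry.

(* Only the values of [F] on the boundary strip and of [u] on the enlarged
   domain matter. *)
Definition dpp_solution (R : realType) (n : nat) (Omega : set 'rV[R]_n)
    (eps alpha beta : R) (F u : 'rV[R]_n -> R) : Prop :=
  let lambda := lebesgue_rV R n in
  [/\ measurable_fun (enlarged Omega eps) u,
      bounded_on (enlarged Omega eps) u,
      (forall x, boundary_strip Omega eps x -> u x = F x) &
      forall x, Omega x ->
        u x = alpha / 2 * sup (u @` eball x eps)
            + alpha / 2 * inf (u @` eball x eps)
            + beta / fine (lambda (eball x eps))
              * \int[lambda]_(y in eball x eps) u y].

(* The information x_0, ..., x_k, c_1, ..., c_k available at time k. *)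
Definition history (R : realType) (n k : nat) : Type :=
  (k.+1.-tuple 'rV[R]_n * k.-tuple 'I_3)%type.

HB.instance Definition _ (R : realType) (n k : nat) :=
  Measurable.on (history R n k).

Definition current (R : realType) (n k : nat) (h : history R n k) :
  'rV[R]_n := tnth h.1 ord_max.

Definition strategy (R : realType) (n : nat) : Type :=
  forall k : nat, history R n k -> 'rV[R]_n.

Variant information :=
  CurrentLocation | LocationHistory | LocationAndTossHistory.

(* Borel strategies that use no more than the given information; the next
   position may depend on the step k in each of the three cases. *)
Definition uses_only (R : realType) (n : nat) (a : information)
    (S : strategy R n) : Prop :=
  match a with
  | CurrentLocation => exists g : nat -> 'rV[R]_n -> 'rV[R]_n,
      forall k, measurable_fun setT (g k) /\
                forall h : history R n k, S k h = g k (current h)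
  | LocationHistory =>
      exists g : forall k, k.+1.-tuple 'rV[R]_n -> 'rV[R]_n,
      forall k, measurable_fun setT (g k) /\
                forall h : history R n k, S k h = g k h.1
  | LocationAndTossHistory => forall k, measurable_fun setT (S k)
  end.

Definition strategies (R : realType) (n : nat) (eps : R) (a : information) :
    set (strategy R n) :=
  [set S | uses_only a S /\
           forall k (h : history R n k), eball (current h) eps (S k h)].

(* A game sequence w records at time k the pair w k = (x_k, c_(k+1)); the
   sequence space carries the sigma-algebra generated by the coordinates. *)
Definition coordinate_sets (R : realType) (n : nat) :
    set (set (nat -> 'rV[R]_n * 'I_3)) :=
  [set A | exists k (B : set ('rV[R]_n * 'I_3)),
    measurable B /\ A = [set w | B (w k)]].

Definition game_sequence (R : realType) (n : nat) : Type :=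
  g_sigma_algebraType (@coordinate_sets R n).

HB.instance Definition _ (R : realType) (n : nat) :=
  Measurable.on (game_sequence R n).

Section game.
Context {R : realType} {n : nat}.
Variables (Omega : set 'rV[R]_n) (eps alpha beta : R).
Implicit Types (x : 'rV[R]_n) (S : strategy R n) (w : game_sequence R n).

Definition history_of (k : nat) w : history R n k :=
  ([tuple (w i).1 | i < k.+1], [tuple (w i).2 | i < k]).

Definition toss_prob (c : 'I_3) : R :=
  if val c is 2 then beta else alpha / 2.

Definition uniform_ball x (B : set 'rV[R]_n) : \bar R :=
  (((fine (lebesgue_rV R n (eball x eps)))^-1)%:E
    * lebesgue_rV R n (B `&` eball x eps))%E.

(* Law of x_(k+1) given the history until time k and the outcome c of the next
   toss. Once outside Omega the token no longer moves: this continues the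
   sequence after the end of the game and does not affect the payoff. *)
Definition move_law S1 S2 (c : 'I_3) (k : nat) (h : history R n k)
    (B : set 'rV[R]_n) : \bar R :=
  if `[< Omega (current h) >] then
    match val c with
    | 0 => \d_(S1 k h) B
    | 1 => \d_(S2 k h) B
    | _ => uniform_ball (current h) B
    end
  else \d_(current h) B.

Definition is_game_law x0 S1 S2 (P : probability (game_sequence R n) R) :
    Prop :=
  P [set w | (w 0%N).1 = x0] = 1%E /\
  forall (k : nat) (H : set (history R n k)) (c : 'I_3) (B : set 'rV[R]_n),
    measurable H -> measurable B ->
    P [set w | [/\ H (history_of k w), (w k).2 = c & B (w k.+1).1]] =
    (\int[P]_(w in [set w | H (history_of k w)])
       ((toss_prob c)%:E * move_law S1 S2 c (history_of k w) B))%E.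

(* The measure determined by x0 and the strategies: the above conditions
   characterize it (Ionescu-Tulcea). *)
Definition game_law x0 S1 S2 : probability (game_sequence R n) R :=
  get [set P | is_game_law x0 S1 S2 P].

(* F (x_tau), with the irrelevant value 0 on the event tau = +oo, which has
   probability 0. *)
Definition payoff (F : 'rV[R]_n -> R) w : R :=
  match pselect (exists k, `[< boundary_strip Omega eps (w k).1 >]) with
  | left ends => F (w (ex_minn ends)).1
  | right _ => 0
  end.

Definition expected_payoff (F : 'rV[R]_n -> R) x0 S1 S2 : \bar R :=
  'E_(game_law x0 S1 S2)[payoff F].

Definition value_I (F : 'rV[R]_n -> R) (a : information) x0 : \bar R :=
  ereal_sup [set ereal_inf [set expected_payoff F x0 S1 S2
                           | S2 in strategies eps a] | S1 in strategies eps a].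

Definition value_II (F : 'rV[R]_n -> R) (a : information) x0 : \bar R :=
  ereal_inf [set ereal_sup [set expected_payoff F x0 S1 S2
                           | S1 in strategies eps a] | S2 in strategies eps a].

End game.

(* Main.v *)
Require Import Defs.
From HB Require Import structures.
From mathcomp Require Import all_boot all_order all_algebra.
From mathcomp Require Import all_classical all_reals all_analysis.
From mathcomp Require Import measurable_realfun.
From mathcomp Require Import ring lra.

Set Implicit Arguments.
Unset Strict Implicit.
Unset Printing Implicit Defensive.
Import Order.TTheory GRing.Theory Num.Theory.
Import numFieldNormedType.Exports.
Local Open Scope classical_set_scope.
Local Open Scope ring_scope.

(** The game value is governed by two functions: a solution [u] of the dynamic
programming equation, which plays the role of a martingale, and a potential [g]
that forces the game to end.

The potential is an exponential of the first coordinate. Its uniform average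
over a ball is as large a multiple of its value as one likes, so that in each
round it at least doubles on average, even if both tug moves bring it down to 0
([exists_potential]). This has two consequences. First, with the weight
[2 * K - g], where [K] bounds [g], the operator of the equation is a contraction
([dpp_operator_contraction]), so that its iterates converge uniformly to a
bounded Borel solution ([exists_fixed_point]). Second, [g] increases by a fixed
amount [m] in each round and stays below [K], so that the expected duration of
the game is at most [K / m], whatever the strategies ([sum_running]).

Let a player move, whenever he wins the toss, to a point of the ball where [u]
is within [eta] of its supremum, or infimum. This can be done in a Borel way
because countably many points suffice to approach all suprema over open balls
([exists_almost_optimal_move]). Against any opponent, the mean of [u] at the
current position then worsens by at most [eta] in each round, hence by at most
[eta * (K / m)] in all, and [u] is the payoff at the end
([expected_payoff_ge], [values_near_solution]). As [eta] is arbitrary, both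
values are equal to [u]. Such a rule depends only on the current position and
works against every strategy of the richest kind, so that the three alternatives
have the same value; and since the argument applies to every solution, the
solution is unique.

The law of the game exists by the Ionescu-Tulcea theorem, proved here for
sequences in an arbitrary measurable space. Resampling the coordinates one after
the other gives the probabilities of the cylinders; they are continuous at the
empty set ([run_continuity]) and so extend to a measure with the prescribed
conditional laws ([trajectory_law_next]). *)

(** * Lebesgue measure of cubes and Euclidean balls *)

Section lebesgue.
Context {R : realType}.

(** The balls of the library norm are cubes, that is products of intervals, along
which the iterated definition of the measure can be followed. All volumes below
are compared with theirs. *)
Lemma lebesgue_rV_ball n (x : 'rV[R]_n) (r : R) : 0 < r ->
  lebesgue_rV R n (ball x r) = ((r *+ 2) ^+ n)%:E.
Proof.
move=> r0; elim: n x => [|n IH] x.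
  rewrite expr0 /= diracE mem_set//=.
  by split => // i j; case: j.
transitivity ((lebesgue_rV R n \x lebesgue_measure)%E
   (ball (\row_(i < n) x 0 (lift ord_max i)) r `*` ball (x 0 ord_max) r)).
  rewrite /= /lebesgue_rV_step /pushforward; congr (_ _).
  apply/seteqP; split => -[y t] /=.
    move=> [_ h]; split.
      split=> // i j; rewrite mxE ord1.
      by have := h 0 (lift ord_max j); rewrite !mxE liftK.
    by have := h 0 ord_max; rewrite !mxE unlift_none.
  move=> [[_ h] h']; split => // i j; rewrite ord1 mxE.
  case: unliftP => [k ->|-> //]; by have := h 0 k; rewrite mxE.
rewrite product_measure1E; last 2 first.
- by apply: open_measurable_mx; exact: ball_open.
- exact: measurable_ball.
rewrite [X in (X * _)%E]IH [X in (_ * X)%E](lebesgue_measure_ball _ (ltW r0)).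
by rewrite exprS mulrC EFinM.
Qed.

(** A name for the function underlying [lebesgue_rV R n], on which the structure
of sigma-finite measure can be declared. *)
Definition leb n : set 'rV[R]_n -> \bar R := lebesgue_rV R n.
HB.instance Definition _ n := Measure.on (@leb n).

Lemma sigma_finite_leb n : sigma_finite setT (@leb n).
Proof.
exists (fun k => ball (0 : 'rV[R]_n) k.+1%:R) => [|k].
  apply/seteqP; split => // x _; exists (Num.truncn `|x|) => //.
  by rewrite -ball_normE /= sub0r normrN truncnS_gt.
split; first by apply: open_measurable_mx; exact: ball_open.
by rewrite /leb lebesgue_rV_ball// ltry.
Qed.

HB.instance Definition _ n :=
  @Measure_isSigmaFinite.Build _ _ _ (@leb n) (@sigma_finite_leb n).

End lebesgue.

Section geometry.
Context {R : realType} {n : nat}.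
Implicit Types (x y v : 'rV[R]_n) (r eps : R) (Omega : set 'rV[R]_n).

Lemma enorm_ge0 v : 0 <= enorm v.
Proof. exact: sqrtr_ge0. Qed.

Lemma enormN v : enorm (- v) = enorm v.
Proof. by rewrite /enorm; under eq_bigr do rewrite mxE sqrrN. Qed.

Lemma coord_le_enorm v i : `|v 0 i| <= enorm v.
Proof.
rewrite -sqrtr_sqr ler_sqrt ?sumr_ge0// => [|j _]; last exact: sqr_ge0.
by rewrite (bigD1 i)//= lerDl sumr_ge0// => j _; exact: sqr_ge0.
Qed.

Lemma enorm_le_coord v r : (forall i, `|v 0 i| <= r) -> enorm v <= n%:R * r.
Proof.
move=> vr; have [n0|n0] := posnP n.
  rewrite /enorm big1 ?sqrtr0 => [|i _]; first by rewrite n0 mul0r.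
  by have := leq_trans (ltn_ord i) (eq_leq n0).
have r0 : 0 <= r := le_trans (normr_ge0 _) (vr (Ordinal n0)).
rewrite -[leRHS]ger0_norm ?mulr_ge0// -sqrtr_sqr ler_sqrt ?sqr_ge0//.
apply: (@le_trans _ _ (\sum_(i < n) r ^+ 2)).
  apply: ler_sum => i _; rewrite -[leLHS]real_normK ?num_real// ler_sqr ?nnegrE//.
rewrite sumr_const card_ord -(mulr_natl (r ^+ 2)) exprMn ler_wpM2r ?sqr_ge0//.
by rewrite -natrX ler_nat expnS expn1 leq_pmulr.
Qed.

Lemma enorm0 : enorm (0 : 'rV[R]_n) = 0.
Proof. by rewrite /enorm big1 ?sqrtr0// => i _; rewrite mxE expr0n. Qed.

Lemma mem_eball x r : 0 < r -> eball x r x.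
Proof. by move=> r0; rewrite /eball/= subrr enorm0. Qed.

Lemma enorm_continuous : continuous (@enorm R n).
Proof.
move=> v; apply: (@continuous_comp _ _ _
  (fun v : 'rV[R]_n => \sum_(i < n) v 0 i ^+ 2) Num.sqrt).
  apply: (@continuous_big R^o _ +%R 0 xpredT _ 'rV[R]_n (index_enum 'I_n)
    (fun i v => v 0 i ^+ 2)) => [|i _]; first exact: add_continuous.
  by move=> w; apply: (@continuousM R); exact: coord_continuous.
exact: sqrt_continuous.
Qed.

Lemma eball_open x r : open (eball x r).
Proof.
have -> : eball x r = (fun y => enorm (y - x)) @^-1` [set z | z < r] by [].
apply: open_comp; last exact: open_lt.
move=> y _; apply: (@continuous_comp _ _ _ (fun y => y - x) enorm).
  by apply: continuousB; [exact: cvg_id|exact: cst_continuous].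
exact: enorm_continuous.
Qed.

Lemma eball_sym x y r : eball x r y -> eball y r x.
Proof. by rewrite /eball/= -enormN opprB. Qed.

Lemma measurable_eball x r : measurable (eball x r).
Proof. by apply: open_measurable_mx; exact: eball_open. Qed.

Lemma eball_sub_box x r : eball x r `<=` ball x r.
Proof.
move=> y /= xy; rewrite /eball/= in xy; split => [|i j].
  exact: le_lt_trans (enorm_ge0 _) xy.
rewrite ord1 /ball/= (le_lt_trans _ xy)//.
by rewrite distrC (le_trans _ (coord_le_enorm _ j))// !mxE.
Qed.

(** By Tonelli's theorem, this set makes integrals over [eball x r] measurable
in [x]. *)
Lemma measurable_near_pairs r :
  measurable [set xy : 'rV[R]_n * 'rV[R]_n | eball xy.1 r xy.2].
Proof.
have -> : [set xy : 'rV[R]_n * 'rV[R]_n | eball xy.1 r xy.2] =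
    (fun xy => xy.2 - xy.1) @^-1` eball (0 : 'rV[R]_n) r.
  by apply/seteqP; split => -[a b]; rewrite /eball/= subr0.
rewrite -[X in measurable X]setTI.
apply: measurable_fun_rV => //; last exact: measurable_eball.
move=> i; under eq_fun do rewrite !mxE.
have mc := @measurable_coord_rV R n i.
apply: measurable_funB.
  exact: (measurableT_comp mc measurable_snd).
exact: (measurableT_comp mc measurable_fst).
Qed.

End geometry.

Lemma finite_bounded_integrable d (T : measurableType d) (R : realType)
    (mu : {measure set T -> \bar R}) (D : set T) (f : T -> R) (M : R) :
  measurable D -> (mu D < +oo)%E -> measurable_fun D f ->
  (forall x, D x -> `|f x| <= M) -> mu.-integrable D (EFin \o f).
Proof.
move=> mD Doo mf fM; apply: measurable_bounded_integrable => //.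
by exists M; split; rewrite ?num_real// => N MN x /fM /le_trans; apply; exact: ltW.
Qed.

Section uniform_averages.
Context {R : realType} {n : nat}.
Variable eps : R.
Hypotheses (n_gt0 : (0 < n)%N) (eps_gt0 : 0 < eps).
Implicit Types (x y v : 'rV[R]_n) (f g : 'rV[R]_n -> R) (c M N : R).

Local Notation lambda := (lebesgue_rV R n).

Definition ball_volume x : R := fine (lambda (eball x eps)).

Definition ball_average f x : R :=
  (ball_volume x)^-1 * \int[lambda]_(y in eball x eps) f y.

Let r : R := eps / (4 * n%:R).

Let n_gt0R : 0 < n%:R :> R. Proof. by rewrite ltr0n. Qed.

Let r_gt0 : 0 < r. Proof. by rewrite divr_gt0// mulr_gt0. Qed.

(** The cube of half-side [r] around [x + (2 r, ..., 2 r)] fits into the ball and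
lies to the right of [x]. It bounds the volume of the ball from below, and it is
there that the potential grows. *)
Lemma right_box_sub x : ball (x + const_mx (2 * r)) r `<=` eball x eps.
Proof.
move=> y [_ h]; rewrite /eball/=.
apply: (@le_lt_trans _ _ (n%:R * (3 * r))); last first.
  have -> : n%:R * (3 * r) = 3 / 4 * eps by rewrite /r; field; rewrite gt_eqF.
  by move: eps_gt0; lra.
apply: enorm_le_coord => i; have := h 0 i; rewrite !mxE /ball/= => hi.
have -> : y 0 i - x 0 i = 2 * r - (x 0 i + 2 * r - y 0 i) by ring.
have r2 : 0 <= 2 * r by rewrite pmulr_rge0// ltW.
rewrite (le_trans (ler_normB _ _))// ger0_norm//.
by have := ltW hi; lra.
Qed.

Lemma right_box_ge x y : ball (x + const_mx (2 * r)) r y ->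
  x 0 (Ordinal n_gt0) + r <= y 0 (Ordinal n_gt0).
Proof.
move=> [_ /(_ 0 (Ordinal n_gt0))]; rewrite !mxE /ball/= ltr_norml => /andP[_].
lra.
Qed.

Lemma eball_finite x : (lambda (eball x eps) < +oo)%E.
Proof.
apply: (@le_lt_trans _ _ (lambda (ball x eps))).
  apply: le_measure; rewrite ?inE; [exact: measurable_eball| |].
    by apply: open_measurable_mx; exact: ball_open.
  exact: eball_sub_box.
by rewrite lebesgue_rV_ball// ltry.
Qed.

Lemma ball_volumeE x : (ball_volume x)%:E = lambda (eball x eps).
Proof. by rewrite fineK// ge0_fin_numE// eball_finite. Qed.

Lemma ball_volume_le x : ball_volume x <= (eps *+ 2) ^+ n.
Proof.
rewrite -lee_fin ball_volumeE -(lebesgue_rV_ball x)//.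
apply: le_measure; rewrite ?inE; [exact: measurable_eball| |].
  by apply: open_measurable_mx; exact: ball_open.
exact: eball_sub_box.
Qed.

Lemma ball_volume_gt0 x : 0 < ball_volume x.
Proof.
apply: (@lt_le_trans _ _ ((r *+ 2) ^+ n)); first by rewrite exprn_gt0// mulrn_wgt0.
rewrite -lee_fin ball_volumeE -(lebesgue_rV_ball (x + const_mx (2 * r)))//.
apply: le_measure; rewrite ?inE; [|exact: measurable_eball|].
  by apply: open_measurable_mx; exact: ball_open.
exact: right_box_sub.
Qed.

Lemma integrable_eball f M x : measurable_fun setT f ->
  (forall y, `|f y| <= M) -> lambda.-integrable (eball x eps) (EFin \o f).
Proof.
move=> mf fM; apply: (@finite_bounded_integrable _ _ _ _ _ _ M) => //.
- exact: measurable_eball.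
- exact: eball_finite.
- exact: measurable_funTS.
Qed.

Lemma ball_average_cst c x : ball_average (cst c) x = c.
Proof.
rewrite /ball_average Rintegral_cst; last exact: measurable_eball.
by rewrite -/(ball_volume x) mulrCA mulVf ?mulr1// gt_eqF// ball_volume_gt0.
Qed.

Lemma ball_averageD f g M N x : measurable_fun setT f -> measurable_fun setT g ->
  (forall y, `|f y| <= M) -> (forall y, `|g y| <= N) ->
  ball_average (fun y => f y + g y) x = ball_average f x + ball_average g x.
Proof.
move=> mf mg fM gN; rewrite /ball_average -mulrDr; congr (_ * _).
apply: RintegralD.
- exact: measurable_eball.
- exact: integrable_eball fM.
- exact: integrable_eball gN.
Qed.

Lemma ball_averageZ c f M x : measurable_fun setT f -> (forall y, `|f y| <= M) ->
  ball_average (fun y => c * f y) x = c * ball_average f x.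
Proof.
move=> mf fM; rewrite /ball_average mulrCA; congr (_ * _).
apply: RintegralZl; first exact: measurable_eball.
exact: integrable_eball fM.
Qed.

Lemma ball_averageN f M x : measurable_fun setT f -> (forall y, `|f y| <= M) ->
  ball_average (fun y => - f y) x = - ball_average f x.
Proof.
move=> mf fM; under eq_fun do rewrite -mulN1r.
by rewrite (ball_averageZ _ _ mf fM) mulN1r.
Qed.

Lemma le_ball_average f g M N x : measurable_fun setT f -> measurable_fun setT g ->
  (forall y, `|f y| <= M) -> (forall y, `|g y| <= N) ->
  (forall y, eball x eps y -> f y <= g y) ->
  ball_average f x <= ball_average g x.
Proof.
move=> mf mg fM gN fg; rewrite /ball_average ler_pM2l ?invr_gt0 ?ball_volume_gt0//.
apply: le_Rintegral => //.
- exact: measurable_eball.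
- exact: integrable_eball fM.
- exact: integrable_eball gN.
Qed.

Lemma measurable_ge0_ball_integral f : measurable_fun setT f ->
  (forall y, 0 <= f y) ->
  measurable_fun setT (fun x => \int[lambda]_(y in eball x eps) f y).
Proof.
move=> mf f0; pose S := [set xy : 'rV[R]_n * 'rV[R]_n | eball xy.1 eps xy.2].
have mS : measurable S by exact: measurable_near_pairs.
pose h (xy : 'rV[R]_n * 'rV[R]_n) := (f xy.2 * \1_S xy)%:E.
have mh : measurable_fun setT h.
  apply/measurable_EFinP; apply: measurable_funM.
    exact: (measurableT_comp mf measurable_snd).
  exact: measurable_indic.
have h0 xy : (0 <= h xy)%E by rewrite lee_fin mulr_ge0.
have := @measurable_fun_fubini_tonelli_F _ _ _ _ _ (@leb R n) h mh h0.
move=> /(measurableT_comp (@fine_measurable R setT measurableT)) /=.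
congr measurable_fun; apply/funext => x /=.
rewrite /Rintegral integral_mkcond; congr fine.
apply: eq_integral => y _; rewrite /h patchE indicE.
have -> : ((x, y) \in S) = (y \in eball x eps) by rewrite /in_mem/= /S.
by case: ifPn => _; rewrite ?mulr1 ?mulr0.
Qed.

Lemma measurable_ball_volume : measurable_fun setT ball_volume.
Proof.
rewrite (_ : ball_volume = fun x => \int[lambda]_(y in eball x eps) 1).
  exact: measurable_ge0_ball_integral.
by apply/funext => x; rewrite Rintegral_cst ?mul1r//; exact: measurable_eball.
Qed.

Lemma measurable_ball_average f M : measurable_fun setT f ->
  (forall y, `|f y| <= M) -> measurable_fun setT (ball_average f).
Proof.
move=> mf fM.
have -> : ball_average f = fun x => (ball_volume x)^-1 *
    \int[lambda]_(y in eball x eps) (f y + M) - M.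
  (* the shift by [M] makes the integrand nonnegative *)
  apply/funext => x; rewrite -[X in _ - X](ball_average_cst M x) /ball_average.
  rewrite -mulrBr -RintegralB; last 3 first.
  - exact: measurable_eball.
  - apply: (@integrable_eball _ (M + M)); first exact: measurable_funD.
    move=> y; rewrite (le_trans (ler_normD _ _))// lerD//.
    by rewrite ger0_norm// (le_trans _ (fM y)).
  - by apply: (@integrable_eball (cst M) `|M|).
  by congr (_ * _); apply: eq_Rintegral => y _; rewrite addrK.
apply: measurable_funB => //; apply: measurable_funM.
  (* the inverse of a positive function is a composition of measurable ones *)
  rewrite (_ : (fun x => _) = fun x => expR (- ln (ball_volume x))).
    apply: measurableT_comp => //; apply: measurableT_comp => //.
    by apply: measurableT_comp => //; exact: measurable_ball_volume.
  by apply/funext => x; rewrite expRN lnK// posrE ball_volume_gt0.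
apply: measurable_ge0_ball_integral; first exact: measurable_funD.
by move=> y; have := fM y; rewrite ler_norml => /andP[+ _]; lra.
Qed.

End uniform_averages.

(** * The enlarged domain and the potential *)

Section game_domain.
Context {R : realType} {n : nat}.
Variables (Omega : set 'rV[R]_n) (eps : R).
Hypotheses (n_gt0 : (0 < n)%N) (eps_gt0 : 0 < eps).
Hypotheses (dOmega : domain Omega) (bOmega : bounded_set Omega).
Implicit Types (x y v : 'rV[R]_n).

Let Omega_neq0 : Omega !=set0. Proof. by case: dOmega. Qed.

Let distances_neq0 x : [set enorm (x - y) | y in Omega] !=set0.
Proof. by case: Omega_neq0 => y Oy; exists (enorm (x - y)), y. Qed.

Lemma edist_set_lt x a :
  edist_set x Omega < a <-> exists2 y, Omega y & eball y a x.
Proof.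
split=> [/(inf_lt (distances_neq0 x))[_ [y Oy <-]] ?|[y Oy xy]]; first by exists y.
apply: le_lt_trans xy; apply: ge_inf; last by exists y.
by exists 0 => _ [z _ <-]; exact: enorm_ge0.
Qed.

Lemma edist_set_lt_open a : open [set x | edist_set x Omega < a].
Proof.
rewrite (_ : [set x | _] = \bigcup_(y in Omega) eball y a).
  by apply: bigcup_open => y _; exact: eball_open.
by apply/seteqP; split=> x /=; rewrite edist_set_lt => -[y Oy xy]; exists y.
Qed.

Lemma measurable_domain : measurable Omega.
Proof. by apply: open_measurable_mx; case: dOmega. Qed.

Lemma measurable_boundary_strip : measurable (boundary_strip Omega eps).
Proof.
rewrite (_ : boundary_strip Omega eps = ~` Omega `&`
    \bigcap_k [set x | edist_set x Omega < eps + k.+1%:R^-1]).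
  apply: measurableI; first by apply: measurableC; exact: measurable_domain.
  apply: bigcapT_measurable => k; apply: open_measurable_mx.
  exact: edist_set_lt_open.
apply/seteqP; split=> x [Ox xe]; split=> //.
  by move=> k _ /=; rewrite (le_lt_trans xe)// ltrDl invr_gt0.
apply/ler_addgt0Pr => e e0.
have [k _ /(_ k (leqnn k)) ke] := near_infty_natSinv_lt (PosNum e0).
rewrite ltW// (lt_trans (xe k I))//= ltrD2l.
exact: ke.
Qed.

Lemma measurable_enlarged : measurable (enlarged Omega eps).
Proof.
by apply: measurableU; [exact: measurable_boundary_strip|exact: measurable_domain].
Qed.

Lemma eball_sub_enlarged x : Omega x -> eball x eps `<=` enlarged Omega eps.
Proof.
move=> Ox y xy; have [Oy|Oy] := pselect (Omega y); first by right.
by left; split=> //; apply/ltW/edist_set_lt; exists x.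
Qed.

Lemma enlarged_bounded : exists M : R, forall x, enlarged Omega eps x ->
  forall i, `|x 0 i| <= M.
Proof.
have [M [_ /(_ (M + 1))]] := bOmega; rewrite ltrDl ltr01 => /(_ isT) OM.
exists (M + 1 + 2 * eps) => x ex i.
suff [y Oy xy] : exists2 y, Omega y & eball y (2 * eps) x.
  have yM : `|y 0 i| <= M + 1.
    apply: le_trans (OM _ Oy); rewrite [leRHS]mx_normrE.
    exact: (@le_bigmax _ _ _ 0 (fun ij => `|y ij.1 ij.2|) (0, i)).
  have := coord_le_enorm (x - y) i; rewrite !mxE => xyi.
  have -> : x 0 i = y 0 i + (x 0 i - y 0 i) by ring.
  rewrite (le_trans (ler_normD _ _))// lerD//.
  exact: le_trans xyi (ltW xy).
case: ex => [[_ xe]|Ox]; first by apply/edist_set_lt; rewrite (le_lt_trans xe)//; move: eps_gt0; lra.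
by exists x => //; apply: mem_eball; rewrite mulr_gt0.
Qed.

(** The function is [expR (l * x_1)], cut to 0 away from the enlarged domain. A
fixed fraction of the ball around [x] is at distance [r] to the right of [x], so
that the average exceeds the value at [x] by a factor proportional to
[expR (l * r)]. *)
Lemma exists_potential (beta : R) : 0 < beta ->
  exists g : 'rV[R]_n -> R, exists K m : R,
  [/\ measurable_fun setT g, (forall x, 0 <= g x <= K), 0 < m,
      (forall x, Omega x -> m <= g x) &
      forall x, Omega x -> 2 * g x <= beta * ball_average eps g x].
Proof.
move=> b0; pose i0 := Ordinal n_gt0.
have [M ME] := enlarged_bounded.
pose r := eps / (4 * n%:R).
have r0 : 0 < r by rewrite divr_gt0// mulr_gt0// ltr0n.
pose c := beta * (r *+ 2) ^+ n / (eps *+ 2) ^+ n.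
have c0 : 0 < c by rewrite divr_gt0 ?mulr_gt0 ?exprn_gt0 ?mulrn_wgt0.
(* [c] is [beta] times a lower bound for the fraction of the ball filled by the
   right-hand cube, and [l] is such that [c * expR (l * r)] exceeds 2 *)
pose l := ln (1 + 2 / c) / r.
have l0 : 0 <= l by rewrite divr_ge0 ?(ltW r0)// ln_ge0// lerDl divr_ge0// ltW.
have cl : 2 <= c * expR (l * r).
  rewrite /l divfK ?gt_eqF// lnK ?posrE; last by rewrite addr_gt0// divr_gt0.
  by rewrite mulrDr mulr1 mulrCA divff ?gt_eqF// mulr1 lerDr ltW.
pose g (x : 'rV[R]_n) := expR (l * x 0 i0) * \1_(enlarged Omega eps) x.
have mg : measurable_fun setT g.
  apply: measurable_funM.
    apply: measurableT_comp => //; apply: measurable_funM => //.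
    exact: measurable_coord_rV.
  by apply: measurable_indic; exact: measurable_enlarged.
have gK x : 0 <= g x <= expR (l * M).
  rewrite /g indicE; case: (boolP (x \in _)) => [|_]; last by rewrite mulr0 lexx expR_ge0.
  rewrite inE => ex; rewrite mulr1 expR_ge0/= ler_expR ler_wpM2l//.
  by rewrite (le_trans (ler_norm _))// ME.
have gE x : enlarged Omega eps x -> g x = expR (l * x 0 i0).
  by move=> ex; rewrite /g indicE mem_set// mulr1.
exists g, (expR (l * M)), (expR (- (l * M))); split=> //; first exact: expR_gt0.
  move=> x Ox; have ex : enlarged Omega eps x by right.
  rewrite gE// ler_expR -mulrN ler_wpM2l//.
  by have := ME _ ex i0; rewrite ler_norml => /andP[].
move=> x Ox; have ex : enlarged Omega eps x by right.
pose B := ball (x + const_mx (2 * r)) r.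
have mB : measurable B by apply: open_measurable_mx; exact: ball_open.
have gB : expR (l * r) * g x * (r *+ 2) ^+ n <=
    \int[lebesgue_rV R n]_(y in eball x eps) g y.
  rewrite (_ : (r *+ 2) ^+ n = fine (lebesgue_rV R n B)); last first.
    by rewrite /B lebesgue_rV_ball.
  rewrite -(Rintegral_cst _ mB).
  have gM y : `|g y| <= expR (l * M).
    by have /andP[g0 g1] := gK y; rewrite ger0_norm.
  have iB : (lebesgue_rV R n).-integrable B (EFin \o g).
    apply: (@integrableS _ _ _ _ (eball x eps)) => //.
    - exact: measurable_eball.
    - exact: right_box_sub.
    - exact: integrable_eball gM.
  apply: (@le_trans _ _ (\int[lebesgue_rV R n]_(y in B) g y)).
    apply: le_Rintegral => //.
      apply: (@finite_bounded_integrable _ _ _ _ _ _ `|expR (l * r) * g x|) => //.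
      by rewrite [ltLHS](lebesgue_rV_ball _ r0) ltry.
    move=> y By; have ey : enlarged Omega eps y.
      by apply: (eball_sub_enlarged Ox); exact: (right_box_sub n_gt0 eps_gt0).
    rewrite !gE// -expRD ler_expR -mulrDr ler_wpM2l// addrC.
    exact: right_box_ge By.
  rewrite fine_le//.
  - by apply: integrable_fin_num.
  - apply: integrable_fin_num; first exact: measurable_eball.
    exact: integrable_eball gM.
  apply: ge0_subset_integral => //.
  - exact: measurable_eball.
  - by apply/measurable_EFinP; exact: measurable_funTS.
  - by move=> y _; rewrite lee_fin; case/andP: (gK y).
  - exact: right_box_sub.
have V0 := ball_volume_gt0 n_gt0 eps_gt0 x.
have g0 : 0 <= g x by case/andP: (gK x).
apply: (@le_trans _ _ (c * expR (l * r) * g x)); first by rewrite ler_wpM2r.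
rewrite (_ : c * _ * _ = beta * (((eps *+ 2) ^+ n)^-1 *
    (expR (l * r) * g x * (r *+ 2) ^+ n))); last first.
  by rewrite /c [in LHS](mulrC (beta * _) _^-1); ring.
rewrite /ball_average ler_pM2l//.
apply: ler_pM => //.
- by rewrite invr_ge0 exprn_ge0// mulrn_wge0// ltW.
- by rewrite !mulr_ge0 ?expR_ge0 ?exprn_ge0 ?mulrn_wge0// ltW.
rewrite lef_pV2 ?posrE ?exprn_gt0 ?mulrn_wgt0//.
exact: ball_volume_le.
Qed.

End game_domain.

(** * The dynamic programming equation *)

Section ball_extrema.
Context {R : realType} {n : nat}.
Variable eps : R.
Hypothesis eps_gt0 : 0 < eps.
Implicit Types (x y : 'rV[R]_n) (f g w : 'rV[R]_n -> R) (c M D : R).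

Definition ball_sup f x : R := sup (f @` eball x eps).
Definition ball_inf f x : R := inf (f @` eball x eps).

Let image_neq0 f x : f @` eball x eps !=set0.
Proof. by exists (f x), x => //; exact: mem_eball. Qed.

Lemma le_ball_sup f M x y : (forall y, `|f y| <= M) -> eball x eps y ->
  f y <= ball_sup f x.
Proof.
move=> fM xy; apply: ub_le_sup; last by exists y.
by exists M => _ [z _ <-]; rewrite (le_trans (ler_norm _)).
Qed.

Lemma ball_sup_le f x c : (forall y, eball x eps y -> f y <= c) ->
  ball_sup f x <= c.
Proof. by move=> fc; apply: ge_sup => // _ [y xy <-]; exact: fc. Qed.

Lemma ball_supN f x : ball_sup (fun y => - f y) x = - ball_inf f x.
Proof. by rewrite /ball_inf/inf image_comp opprK. Qed.

Lemma ball_infE f x : ball_inf f x = - ball_sup (fun y => - f y) x.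
Proof. by rewrite ball_supN opprK. Qed.

Lemma ball_inf_le f M x y : (forall y, `|f y| <= M) -> eball x eps y ->
  ball_inf f x <= f y.
Proof.
move=> fM xy; rewrite ball_infE lerNl.
by apply: (@le_ball_sup (fun y => - f y) M) => // z; rewrite normrN.
Qed.

(** As the balls are open, the centres [x] for which the supremum exceeds [a] form
the union of the balls around the points where [f] exceeds [a]. *)
Lemma measurable_ball_sup f M : (forall y, `|f y| <= M) ->
  measurable_fun setT (ball_sup f).
Proof.
move=> fM; apply: (measurability _ (RGenOInfty.measurableE R)).
move=> _ [_ [a ->] <-]; rewrite setTI; apply: open_measurable_mx.
rewrite (_ : _ @^-1` _ = \bigcup_(y in [set y | a < f y]) eball y eps).
  by apply: bigcup_open => y _; exact: eball_open.
apply/seteqP; split => [x|x [y /= ay xy]]; rewrite /= in_itv/= andbT.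
  by move=> /(sup_gt (image_neq0 f x))[_ [y xy <-] ay]; exists y => //; exact: eball_sym.
by rewrite (lt_le_trans ay)//; apply: (le_ball_sup fM); exact: eball_sym.
Qed.

Lemma ball_sup_dist f g M D x :
  (forall y, `|f y| <= M) -> (forall y, `|g y| <= M) ->
  (forall y, eball x eps y -> `|f y - g y| <= D) ->
  `|ball_sup f x - ball_sup g x| <= D.
Proof.
move=> fM gM fgD; rewrite ler_distl; apply/andP; split; last first.
  apply: ball_sup_le => y xy; have := fgD _ xy; rewrite ler_norml => /andP[_].
  by have := le_ball_sup gM xy; lra.
rewrite lerBlDr; apply: ball_sup_le => y xy.
have := fgD _ xy; rewrite ler_norml => /andP[+ _].
by have := le_ball_sup fM xy; lra.
Qed.

Lemma ball_inf_dist f g M D x :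
  (forall y, `|f y| <= M) -> (forall y, `|g y| <= M) ->
  (forall y, eball x eps y -> `|f y - g y| <= D) ->
  `|ball_inf f x - ball_inf g x| <= D.
Proof.
move=> fM gM fgD; rewrite !ball_infE -opprD normrN.
apply: (@ball_sup_dist _ _ M) => y; rewrite ?normrN//.
by move=> xy; rewrite -opprD normrN; exact: fgD.
Qed.

End ball_extrema.

Section fixed_point.
Context {R : realType} {n : nat}.
Variables (Omega : set 'rV[R]_n) (eps alpha beta : R) (F : 'rV[R]_n -> R).
Hypotheses (n_gt0 : (0 < n)%N) (eps_gt0 : 0 < eps).
Hypothesis dOmega : domain Omega.
Hypotheses (alpha_gt0 : 0 < alpha) (beta_gt0 : 0 < beta)
  (alphaDbeta : alpha + beta = 1).
Hypothesis mF : measurable_fun (boundary_strip Omega eps) F.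
Implicit Types (x y : 'rV[R]_n) (v w : 'rV[R]_n -> R) (M W : R).

Local Notation lambda := (lebesgue_rV R n).

Definition tug_average v x : R :=
  alpha / 2 * ball_sup eps v x + alpha / 2 * ball_inf eps v x +
  beta * ball_average eps v x.

Definition dpp_operator v x : R :=
  (tug_average v \_ Omega) x + (F \_ (boundary_strip Omega eps)) x.

Lemma dpp_operator_in v x : Omega x -> dpp_operator v x = tug_average v x.
Proof.
move=> Ox; have Gx : ~ boundary_strip Omega eps x by case.
by rewrite /dpp_operator !patchE (mem_set Ox) (memNset Gx) addr0.
Qed.

Lemma dpp_operator_strip v x : boundary_strip Omega eps x ->
  dpp_operator v x = F x.
Proof.
move=> Gx; have Ox : ~ Omega x by case: Gx.
by rewrite /dpp_operator !patchE (mem_set Gx) (memNset Ox) add0r.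
Qed.

Lemma dpp_operator_out v x : ~ enlarged Omega eps x -> dpp_operator v x = 0.
Proof.
move=> Ex; have Ox : ~ Omega x by move=> Ox; apply: Ex; right.
have Gx : ~ boundary_strip Omega eps x by move=> Gx; apply: Ex; left.
by rewrite /dpp_operator !patchE (memNset Ox) (memNset Gx) addr0.
Qed.

Lemma measurable_dpp_operator v M : measurable_fun setT v ->
  (forall y, `|v y| <= M) -> measurable_fun setT (dpp_operator v).
Proof.
move=> mv vM; apply: measurable_funD; last first.
  exact: (measurable_restrictT F (measurable_boundary_strip eps dOmega)).1 mF.
apply: (measurable_restrictT _ (measurable_domain dOmega)).1.
apply: measurable_funTS; apply: measurable_funD; last first.
  by apply: measurable_funM => //; exact: (measurable_ball_average n_gt0 eps_gt0 mv vM).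
apply: measurable_funD; apply: measurable_funM => //.
  exact: (measurable_ball_sup eps_gt0 vM).
rewrite (_ : ball_inf eps v = fun x => - ball_sup eps (fun y => - v y) x).
  apply: measurable_funN; apply: (@measurable_ball_sup _ _ _ eps_gt0 _ M) => y.
  by rewrite normrN.
by apply/funext => x; exact: ball_infE.
Qed.

(** The tug part sees only the maximum of the bound [w], while the noise part
averages it; a weight that averages well over balls therefore contracts. *)
Lemma tug_average_dist v v' w M W x :
  measurable_fun setT v -> measurable_fun setT v' -> measurable_fun setT w ->
  (forall y, `|v y| <= M) -> (forall y, `|v' y| <= M) ->
  (forall y, `|v y - v' y| <= w y <= W) ->
  `|tug_average v x - tug_average v' x| <= alpha * W + beta * ball_average eps w x.
Proof.
move=> mv mv' mw vM v'M vv'.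
have vW y : `|v y - v' y| <= W by have /andP[h /(le_trans h)] := vv' y.
have wW y : `|w y| <= W.
  by have /andP[h ?] := vv' y; rewrite ger0_norm// (le_trans _ h).
have avg : `|ball_average eps v x - ball_average eps v' x| <= ball_average eps w x.
  rewrite ler_distl; apply/andP; split.
    rewrite lerBlDr -(ball_averageD eps_gt0 x mv mw vM wW).
    apply: (@le_ball_average _ _ _ n_gt0 eps_gt0 _ _ M (M + W)) => //.
      exact: measurable_funD.
      by move=> y; rewrite (le_trans (ler_normD _ _))// lerD.
    by move=> y _; have /andP[+ _] := vv' y; rewrite ler_norml => /andP[]; lra.
  rewrite -(ball_averageD eps_gt0 x mv' mw v'M wW).
  apply: (@le_ball_average _ _ _ n_gt0 eps_gt0 _ _ M (M + W)) => //.
    exact: measurable_funD.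
    by move=> y; rewrite (le_trans (ler_normD _ _))// lerD.
  by move=> y _; have /andP[+ _] := vv' y; rewrite ler_norml => /andP[]; lra.
have s := @ball_sup_dist _ _ _ eps_gt0 v v' M W x vM v'M (fun y _ => vW y).
have i := @ball_inf_dist _ _ _ eps_gt0 v v' M W x vM v'M (fun y _ => vW y).
rewrite /tug_average [X in `|X|](_ : _ =
  alpha / 2 * (ball_sup eps v x - ball_sup eps v' x) +
  alpha / 2 * (ball_inf eps v x - ball_inf eps v' x) +
  beta * (ball_average eps v x - ball_average eps v' x)); last by ring.
have a2 : 0 <= alpha / 2 by rewrite divr_ge0// ltW.
rewrite (le_trans (ler_normD _ _))// lerD//; last first.
  by rewrite normrM gtr0_norm// ler_pM2l.
rewrite [leRHS](_ : _ = alpha / 2 * W + alpha / 2 * W); last by field.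
by rewrite (le_trans (ler_normD _ _))// lerD// normrM ger0_norm// ler_wpM2l.
Qed.

Lemma tug_average_norm v M x : measurable_fun setT v ->
  (forall y, `|v y| <= M) -> `|tug_average v x| <= M.
Proof.
move=> mv vM; have := @tug_average_dist v (cst 0) (cst M) M M x mv.
rewrite (_ : tug_average (cst 0) x = 0); last first.
  rewrite /tug_average (ball_average_cst n_gt0 eps_gt0) /ball_sup /ball_inf.
  rewrite (_ : cst 0 @` _ = [set 0]) ?sup1 ?inf1; first by ring.
  apply/seteqP; split=> [_ [y _ <-]//|_ ->]; exists x => //; exact: mem_eball.
rewrite (ball_average_cst n_gt0 eps_gt0) -mulrDl alphaDbeta mul1r subr0; apply => //.
  by move=> y; rewrite normr0 (le_trans _ (vM y)).
by move=> y; rewrite subr0 lexx andbT.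
Qed.

Lemma dpp_operator_norm v M : measurable_fun setT v ->
  (forall y, `|v y| <= M) ->
  (forall x, boundary_strip Omega eps x -> `|F x| <= M) ->
  forall x, `|dpp_operator v x| <= M.
Proof.
move=> mv vM FM x; have [[Gx|Ox]|Ex] := pselect (enlarged Omega eps x).
- by rewrite dpp_operator_strip// FM.
- by rewrite dpp_operator_in// tug_average_norm.
- by rewrite dpp_operator_out// normr0 (le_trans _ (vM x)).
Qed.

End fixed_point.

Section fixed_point_existence.
Context {R : realType} {n : nat}.
Variables (Omega : set 'rV[R]_n) (eps alpha beta : R) (F : 'rV[R]_n -> R).
Hypotheses (n_gt0 : (0 < n)%N) (eps_gt0 : 0 < eps).
Hypotheses (dOmega : domain Omega) (bOmega : bounded_set Omega).
Hypotheses (alpha_gt0 : 0 < alpha) (beta_gt0 : 0 < beta)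
  (alphaDbeta : alpha + beta = 1).
Hypothesis mF : measurable_fun (boundary_strip Omega eps) F.
Implicit Types (x y : 'rV[R]_n) (v w : 'rV[R]_n -> R) (M N : R).

Local Notation T := (dpp_operator Omega eps alpha beta F).

(** The weight [2 * K - g] turns the operator into a contraction: the tug part
costs at most [alpha * (2 * K)], while the noise part gains [2 * g x] and one
half of this gain is left over. *)
Lemma dpp_operator_contraction (g : 'rV[R]_n -> R) (K m : R) v v' M N x :
  measurable_fun setT g -> (forall x, 0 <= g x <= K) ->
  (forall x, Omega x -> m <= g x) -> 0 < K -> 0 < m ->
  (forall x, Omega x -> 2 * g x <= beta * ball_average eps g x) ->
  measurable_fun setT v -> measurable_fun setT v' ->
  (forall y, `|v y| <= M) -> (forall y, `|v' y| <= M) -> 0 <= N ->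
  m <= K ->
  (forall y, `|v y - v' y| <= N * (2 * K - g y)) ->
  `|T v x - T v' x| <= (1 - m / (2 * K)) * N * (2 * K - g x).
Proof.
move=> mg gK gm K0 m0 gavg mv mv' vM v'M N0 mK vv'.
have gx0 y : 0 <= g y by case/andP: (gK y).
have gKy y : g y <= K by case/andP: (gK y).
have t0 : 0 <= 1 - m / (2 * K).
  by rewrite subr_ge0 ler_pdivrMr ?mulr_gt0// mul1r; lra.
have R0 : 0 <= (1 - m / (2 * K)) * N * (2 * K - g x).
  by rewrite !mulr_ge0//; have := gKy x; lra.
have [[Gx|Ox]|Ex] := pselect (enlarged Omega eps x).
- by rewrite !dpp_operator_strip// subrr normr0.
- rewrite !dpp_operator_in//.
  have gN y : `|g y| <= K by rewrite ger0_norm.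
  have mw : measurable_fun setT (fun y => N * (2 * K - g y)).
    by apply: measurable_funM => //; exact: measurable_funB.
  have := @tug_average_dist _ _ _ alpha beta n_gt0 eps_gt0 alpha_gt0 beta_gt0
    v v' _ M (N * (2 * K)) x mv mv' mw vM v'M.
  move=> /(_ _)/le_trans; apply.
    by move=> y; rewrite vv' ler_wpM2l//; have := gx0 y; lra.
  have -> : ball_average eps (fun y => N * (2 * K - g y)) x =
      N * (2 * K - ball_average eps g x).
    rewrite (@ball_averageZ _ _ _ eps_gt0 N _ (2 * K + K)) //; last 2 first.
    - exact: measurable_funB.
    - move=> y; rewrite (le_trans (ler_normB _ _))// lerD//.
      by rewrite ger0_norm// mulr_ge0// ltW.
    congr (_ * _).
    rewrite (@ball_averageD _ _ _ eps_gt0 (cst (2 * K)) _ (2 * K) K)//.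
    - by rewrite ball_average_cst// (ball_averageN eps_gt0 _ mg gN).
    - exact: measurable_funN.
    - by move=> y; rewrite ger0_norm// mulr_ge0// ltW.
    - by move=> y; rewrite normrN.
  have h : 2 * K - beta * ball_average eps g x <=
      (1 - m / (2 * K)) * (2 * K - g x).
    apply: (@le_trans _ _ (2 * K - 2 * g x)); first by rewrite lerB// gavg.
    have -> : 2 * K - 2 * g x = (2 * K - g x) - g x by ring.
    rewrite mulrBl mul1r lerB//.
    apply: (@le_trans _ _ (m / (2 * K) * (2 * K))).
      by rewrite ler_wpM2l ?divr_ge0 ?mulr_ge0 ?(ltW m0) ?(ltW K0)//; have := gx0 x; lra.
    by rewrite divfK ?gm// gt_eqF// mulr_gt0.
  rewrite [leLHS](_ : _ = N * (2 * K - beta * ball_average eps g x)); last first.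
    transitivity (N * ((alpha + beta) * (2 * K) - beta * ball_average eps g x)).
      by ring.
    by rewrite alphaDbeta mul1r.
  by rewrite [leRHS](_ : _ = N * ((1 - m / (2 * K)) * (2 * K - g x)));
    [rewrite ler_wpM2l|ring].
- by rewrite !dpp_operator_out// subrr normr0.
Qed.

(** The iterates [U k] from 0 have increments of order [t ^+ k], with [t < 1]. So
[U k - D * t ^+ k] increases, [U k + D * t ^+ k] decreases, and what they enclose
is a uniform limit. *)
Lemma exists_fixed_point M : (forall x, boundary_strip Omega eps x -> `|F x| <= M) ->
  0 <= M ->
  exists u : 'rV[R]_n -> R, [/\ measurable_fun setT u, (forall x, `|u x| <= M) &
    forall x, u x = T u x].
Proof.
move=> FM M0.
have [g [K [m [mg gK m0 gm gavg]]]] :=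
  exists_potential n_gt0 eps_gt0 dOmega bOmega beta_gt0.
have [x0 Ox0] : Omega !=set0 by case: dOmega.
have mK : m <= K by apply: le_trans (gm _ Ox0) _; case/andP: (gK x0).
have K0 : 0 < K := lt_le_trans m0 mK.
pose t := 1 - m / (2 * K).
have t1 : t < 1 by rewrite /t ltrBlDr ltrDl divr_gt0// mulr_gt0.
have t0 : 0 <= t by rewrite /t subr_ge0 ler_pdivrMr ?mulr_gt0// mul1r; lra.
pose U k := iter k T (cst 0).
have mU : forall k, measurable_fun setT (U k) /\ forall x, `|U k x| <= M.
  elim=> [|k [mk kM]]; first by split=> // x; rewrite normr0.
  split; first exact: (@measurable_dpp_operator _ _ _ _ _ _ _ n_gt0 eps_gt0 dOmega mF _ M).
  exact: dpp_operator_norm.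
pose N := M / K.
have N0 : 0 <= N by rewrite divr_ge0// ltW.
have step k x : `|U k.+1 x - U k x| <= t ^+ k * N * (2 * K - g x).
  elim: k x => [|k IH] x.
    rewrite subr0 expr0 mul1r; apply: le_trans ((mU 1%N).2 x) _.
    rewrite /N mulrAC ler_pdivlMr// ler_wpM2l//.
    by have /andP[_] := gK x; lra.
  rewrite exprS -(mulrA t).
  apply: (@dpp_operator_contraction g K m (U k.+1) (U k) M _ x) => //.
  - exact: (mU _).1.
  - exact: (mU _).1.
  - exact: (mU _).2.
  - exact: (mU _).2.
  - by apply: mulr_ge0 => //; exact: exprn_ge0.
have steps k x : `|U k.+1 x - U k x| <= t ^+ k * (2 * K * N).
  apply: le_trans (step k x) _; rewrite -(mulrA (t ^+ k)) ler_wpM2l ?exprn_ge0//.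
  by rewrite mulrC ler_wpM2r//; have /andP[+ _] := gK x; lra.
have [D D0 DE] : exists2 D : R, 0 <= D & 2 * K * N = D * (1 - t).
  exists (2 * K * N / (1 - t)); last by rewrite divfK// subr_eq0 gt_eqF.
  apply: divr_ge0; last by rewrite subr_ge0 ltW.
  by apply: mulr_ge0 => //; apply: mulr_ge0 => //; exact: ltW.
pose a k x := U k x - D * t ^+ k; pose b k x := U k x + D * t ^+ k.
have aS k x : a k x <= a k.+1 x.
  have := steps k x; rewrite DE ler_norml => /andP[+ _].
  by rewrite /a exprS; set p := t ^+ k; lra.
have bS k x : b k.+1 x <= b k x.
  have := steps k x; rewrite DE ler_norml => /andP[_].
  by rewrite /b exprS; set p := t ^+ k; lra.
have ab k l x : a k x <= b l x.
  have amono i j : (i <= j)%N -> a i x <= a j x.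
    move=> ij; rewrite -(subnK ij); elim: (j - i)%N => // p IH.
    exact: le_trans IH (aS _ x).
  have bmono i j : (i <= j)%N -> b j x <= b i x.
    move=> ij; rewrite -(subnK ij); elim: (j - i)%N => // p IH.
    exact: le_trans (bS _ x) IH.
  apply: (@le_trans _ _ (a (maxn k l) x)); first by rewrite amono// leq_maxl.
  apply: (@le_trans _ _ (b (maxn k l) x)); last by rewrite bmono// leq_maxr.
  by rewrite /a /b; have := mulr_ge0 D0 (exprn_ge0 (maxn k l) t0); lra.
pose u x := sup [set a k x | k in setT].
have uU k x : `|u x - U k x| <= D * t ^+ k.
  rewrite ler_distl; apply/andP; split.
    by apply: ub_le_sup; [exists (b 0%N x) => _ [l _ <-]|exists k].
  by apply: ge_sup; [exists (a k x), k|move=> _ [l _ <-]; exact: ab].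
have tk0 : (D * t ^+ k) @[k --> \oo] --> 0.
  rewrite -[X in _ --> X](mulr0 D); apply: cvgMr; apply: cvg_expr.
  by rewrite ger0_norm.
have Uu x : U k x @[k --> \oo] --> u x.
  apply/cvgrPdist_le => e e0; move/cvgr0Pnorm_le: tk0 => /(_ e e0).
  apply: filterS => k; rewrite ger0_norm ?mulr_ge0 ?exprn_ge0//.
  exact: le_trans (uU k x).
have mu : measurable_fun setT u.
  by apply: (measurable_fun_cvg (h := U)) => [k|x _]; [exact: (mU k).1|exact: Uu].
have uM x : `|u x| <= M.
  apply/ler_addgt0Pr => e e0.
  move/cvgr0Pnorm_le: tk0 => /(_ e e0)[k _ /(_ k (leqnn k))]/=.
  rewrite ger0_norm ?mulr_ge0 ?exprn_ge0// => ke.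
  have -> : u x = U k x + (u x - U k x) by ring.
  by rewrite (le_trans (ler_normD _ _))// lerD ?(mU k).2// (le_trans (uU k x)).
exists u; split=> // x; apply/eqP; rewrite -subr_eq0 -normr_le0.
apply/ler_addgt0Pr => e e0; rewrite add0r.
have e2 : 0 < e / 2 by rewrite divr_gt0.
move/cvgr0Pnorm_le: tk0 => /(_ _ e2)[k _ /(_ k (leqnn k))]/=.
have Dk : 0 <= D * t ^+ k by rewrite mulr_ge0 ?exprn_ge0.
rewrite ger0_norm// => ke.
have [[Gx|Ox]|Ex] := pselect (enlarged Omega eps x); last first.
- rewrite dpp_operator_out// subr0.
  apply: (@le_trans _ _ (D * t ^+ k.+1)).
    by have := uU k.+1 x; rewrite /= dpp_operator_out// subr0.
  by rewrite exprS mulrCA (le_trans (ler_piMl _ (ltW t1)))// (le_trans ke)//; lra.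
- have h1 := uU k.+1 x; rewrite [U _]/= dpp_operator_in// in h1.
  have h2 : `|tug_average eps alpha beta (U k) x - tug_average eps alpha beta u x|
      <= D * t ^+ k.
    have := @tug_average_dist _ _ _ alpha beta n_gt0 eps_gt0 alpha_gt0 beta_gt0
      (U k) u (cst (D * t ^+ k)) M (D * t ^+ k) x (mU k).1 mu _ (mU k).2 uM.
    rewrite (ball_average_cst n_gt0 eps_gt0) -mulrDl alphaDbeta mul1r; apply => //.
    by move=> y; rewrite distrC uU lexx.
  rewrite dpp_operator_in//.
  have h3 : D * t ^+ k.+1 <= D * t ^+ k.
    by rewrite exprS mulrCA ler_piMl// ltW.
  rewrite (_ : u x - _ = (u x - tug_average eps alpha beta (U k) x) +
    (tug_average eps alpha beta (U k) x - tug_average eps alpha beta u x)); last by ring.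
  rewrite (le_trans (ler_normD _ _))//; lra.
- rewrite dpp_operator_strip//.
  apply: (@le_trans _ _ (D * t ^+ k.+1)).
    by have := uU k.+1 x; rewrite /= dpp_operator_strip.
  by rewrite exprS mulrCA (le_trans (ler_piMl _ (ltW t1)))// (le_trans ke)//; lra.
Qed.

End fixed_point_existence.

(** * Borel almost optimal moves *)

Lemma measurable_first_choice d d' (T : measurableType d) (T' : measurableType d')
    (E : nat -> set T) (z : nat -> T')
    (cover : forall t, exists j, `[< E j t >]) :
  (forall j, measurable (E j)) ->
  measurable_fun setT (fun t => z (ex_minn (cover t))).
Proof.
move=> mE _ U mU; rewrite setTI.
rewrite (_ : _ @^-1` U =
    \bigcup_(j in [set j | U (z j)]) (E j `\` \big[setU/set0]_(i < j) E i)).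
  apply: bigcup_measurable => j _; apply: measurableD => //.
  exact: bigsetU_measurable.
apply/seteqP; split => [t /= Ut|t [j /= Uj [Ejt nEt]]].
  case: ex_minnP Ut => j /asboolP Ejt jmin Uj; exists j => //=.
  split=> //; rewrite -bigcup_mkord => -[i /= ij /asboolP/jmin].
  by rewrite leqNgt ij.
case: ex_minnP => i /asboolP Eit imin.
suff -> : i = j by [].
apply/eqP; rewrite eqn_leq imin ?andTb; last exact/asboolP.
by rewrite leqNgt; apply/negP => ij; apply: nEt; rewrite -bigcup_mkord; exists i.
Qed.

(** It is enough to choose a point above each rational level in each rational
cube that contains one. *)
Lemma exists_countable_witnesses (R : realType) n (v : 'rV[R]_n -> R) :
  exists z : nat -> 'rV[R]_n, forall (O : set 'rV[R]_n) y a,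
    open O -> O y -> a < v y -> exists j, O (z j) /\ a < v (z j).
Proof.
pose q (u : 'rV[rat]_n) : 'rV[R]_n := map_mx ratr u.
pose I := ('rV[rat]_n * nat * rat)%type.
pose good (i : I) y := ball (q i.1.1) (i.1.2.+1%:R^-1 : R) y /\ ratr i.2 < v y.
pose w (i : I) := xget (0 : 'rV[R]_n) (good i).
exists (fun j => if unpickle j is Some i then w i else 0) => O y a oO Oy av.
have /nbhs_ballP[e /= e0 eO] : nbhs y O by exact: open_nbhs_nbhs.
have e20 : 0 < e / 2 by rewrite divr_gt0.
have [k _ /(_ k (leqnn k)) ke] := near_infty_natSinv_lt (PosNum e20).
rewrite /= in ke.
have k0 : 0 < k.+1%:R^-1 :> R by rewrite invr_gt0.
have /choice[u uP] : forall i, exists r : rat, ball (y 0 i) (k.+1%:R^-1) (ratr r : R).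
  move=> i; have := @dense_rat R (ball (y 0 i) k.+1%:R^-1).
  case; [by exists (y 0 i); exact: ballxx|exact: ball_open|].
  by move=> x [/= yx [r _ rE]]; exists r; rewrite rE.
have [s] := @rat_in_itvoo R _ _ av; rewrite in_itv/= => /andP[as_ sv].
have yu : ball (q (\row_i u i)) (k.+1%:R^-1) y.
  apply: ball_sym; split => // i j; rewrite !mxE ord1; exact: uP.
have [wu ws] : good (\row_i u i, k, s) (w (\row_i u i, k, s)) by apply: xgetPex; exists y.
exists (pickle (\row_i u i, k, s)); rewrite pickleK; split; last exact: lt_trans ws.
apply: eO; move: wu yu; rewrite -!ball_normE/= => wu yu.
rewrite (le_lt_trans (ler_distD (q (\row_i u i)) _ _))// [ltRHS]splitr ltrD//.
  by rewrite distrC (lt_trans yu).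
exact: lt_trans wu ke.
Qed.

(** The first of countably many candidate points that is admissible and almost
optimal from [x] depends measurably on [x]. *)
Lemma exists_almost_optimal_move (R : realType) n (eps M : R) (v : 'rV[R]_n -> R) (eta : R) :
  0 < eps -> 0 < eta -> (forall y, `|v y| <= M) ->
  exists s : 'rV[R]_n -> 'rV[R]_n, [/\ measurable_fun setT s,
    forall x, eball x eps (s x) & forall x, ball_sup eps v x - eta < v (s x)].
Proof.
move=> eps0 eta0 vM; have [z zP] := exists_countable_witnesses v.
pose E j := [set x | eball x eps (z j) /\ ball_sup eps v x - eta < v (z j)].
have cover x : exists j, `[< E j x >].
  have : ball_sup eps v x - eta < ball_sup eps v x by rewrite ltrBlDr ltrDl.
  move=> /sup_gt[|_ [y xy <-] vy].
    by exists (v x), x => //; exact: mem_eball.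
  have [j] := zP _ _ _ (@eball_open _ _ x eps) xy vy.
  by exists j; apply/asboolP.
have mE j : measurable (E j).
  rewrite (_ : E j = eball (z j) eps `&`
      ball_sup eps v @^-1` `]-oo, v (z j) + eta[%classic).
    apply: measurableI; first exact: measurable_eball.
    by rewrite -[X in measurable X]setTI; exact: (measurable_ball_sup eps0 vM).
  by apply/seteqP; split => x []; rewrite /E /= in_itv/= ltrBlDr => /eball_sym.
exists (fun x => z (ex_minn (cover x))); split.
- exact: measurable_first_choice.
- by move=> x; case: ex_minnP => j /asboolP[].
- by move=> x; case: ex_minnP => j /asboolP[].
Qed.

(** * The Ionescu-Tulcea theorem *)

Definition coordinate_events d (T : measurableType d) : set (set (nat -> T)) :=
  [set A | exists k (B : set T), measurable B /\ A = [set w | B (w k)]].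

Definition sequence_space d (T : measurableType d) : Type :=
  g_sigma_algebraType (@coordinate_events d T).

HB.instance Definition _ d (T : measurableType d) :=
  Measurable.on (sequence_space T).

Section sequence_space.
Context d (T : measurableType d).
Local Notation S := (sequence_space T).

Lemma measurable_coordinate k : measurable_fun setT (fun w : S => w k).
Proof.
move=> _ B mB; rewrite setTI; apply: sub_sigma_algebra.
by exists k, B.
Qed.

Lemma measurable_to_sequences d' (X : measurableType d') (f : X -> S) :
  (forall k, measurable_fun setT (fun x => f x k)) -> measurable_fun setT f.
Proof.
move=> mf.
apply: (@measurability _ _ X S setT f (@coordinate_events d T : set (set S))) => //.
move=> _ [_ [k [B [mB ->]]] <-]; rewrite setTI.
by have := mf k measurableT _ mB; rewrite setTI.
Qed.

Definition determined_by (k : nat) (A : set S) : Prop :=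
  forall w w' : S, (forall i, (i <= k)%N -> w i = w' i) -> A w -> A w'.

Lemma determined_byW k l A : (k <= l)%N -> determined_by k A -> determined_by l A.
Proof.
by move=> kl dA w w' ww'; apply: dA => i ik; apply: ww'; exact: leq_trans kl.
Qed.

Lemma determined_byC k A : determined_by k A -> determined_by k (~` A).
Proof. by move=> dA w w' ww' nAw Aw'; apply: nAw; apply: dA Aw' => i /ww' ->. Qed.

Lemma determined_byI k A B : determined_by k A -> determined_by k B ->
  determined_by k (A `&` B).
Proof.
by move=> dA dB w w' ww' [Aw Bw]; split; [exact: dA Aw|exact: dB Bw].
Qed.

Lemma determined_byU k A B : determined_by k A -> determined_by k B ->
  determined_by k (A `|` B).
Proof.
by move=> dA dB w w' ww' [Aw|Bw]; [left; exact: dA Aw|right; exact: dB Bw].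
Qed.

Definition cylinder (A : set S) : Prop :=
  measurable A /\ exists k, determined_by k A.

Lemma cylinder0 : cylinder set0.
Proof. by split=> //; exists 0%N. Qed.

Lemma cylinderU : setU_closed cylinder.
Proof.
move=> A B [mA [k dA]] [mB [l dB]]; split; first exact: measurableU.
exists (maxn k l); apply: determined_byU.
  by apply: determined_byW dA; exact: leq_maxl.
by apply: determined_byW dB; exact: leq_maxr.
Qed.

Lemma cylinderC : setC_closed cylinder.
Proof.
move=> A [mA [k dA]]; split; first exact: measurableC.
by exists k; exact: determined_byC.
Qed.

Definition update k (wx : S * T) : S := fun i => if i == k then wx.2 else wx.1 i.

Lemma measurable_update k : measurable_fun setT (update k).
Proof.
apply: measurable_to_sequences => i; rewrite /update; case: eqP => _.
  exact: measurable_snd.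
exact: (measurableT_comp (measurable_coordinate i) measurable_fst).
Qed.

Definition truncate k (w : S) : S := fun i => if (i <= k)%N then w i else point.

Lemma measurable_truncate k : measurable_fun setT (truncate k).
Proof.
apply: measurable_to_sequences => i; rewrite /truncate; case: (leqP i k) => _.
  exact: measurable_coordinate.
exact: measurable_cst.
Qed.

Lemma determined_by_truncate k A : determined_by k (truncate k @^-1` A).
Proof.
move=> w w' ww'; rewrite /preimage/=.
suff -> : truncate k w = truncate k w' by [].
by apply/funext => i; rewrite /truncate; case: leqP => // /ww'.
Qed.

End sequence_space.

(** The algebra of cylinders, kept apart from the sigma-algebra it generates. *)
Definition cylinder_algebra d (T : measurableType d) : Type := nat -> T.

HB.instance Definition _ d (T : measurableType d) :=
  Pointed.on (cylinder_algebra T).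

HB.instance Definition _ d (T : measurableType d) :=
  @isAlgebraOfSets.Build default_measure_display (cylinder_algebra T)
    (@cylinder d T) (@cylinder0 d T) (@cylinderU d T) (@cylinderC d T).

Lemma integral_mkcomp_noparam d0 d1 d2 (X : measurableType d0)
    (Y : measurableType d1) (Z : measurableType d2) (R : realType)
    (k1 : R.-spker X ~> Y) (k2 : R.-spker Y ~> Z) (x : X) (f : Z -> \bar R) :
  (forall z, (0 <= f z)%E) -> measurable_fun setT f ->
  (\int[mkcomp_noparam k1 k2 x]_z f z = \int[k1 x]_y \int[k2 y]_z f z)%E.
Proof.
move=> f0 mf; exact: (integral_kcomp k1 (kernel.kernel_snd k2) x f0 mf).
Qed.

Section trajectories.
Context d (T : measurableType d) (R : realType).
Local Notation S := (sequence_space T).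
Variable kappa : nat -> R.-pker S ~> T.
Local Open Scope ereal_scope.

Definition resample k : S -> {measure set S -> \bar R} :=
  mkcomp (kappa k) (kdirac (@measurable_update _ T k.+1)).

HB.instance Definition _ k := SFiniteKernel.on (resample k).

Lemma integral_resample k w (f : S -> \bar R) :
  (forall z, 0 <= f z) -> measurable_fun setT f ->
  \int[resample k w]_z f z = \int[kappa k w]_x f (update k.+1 (w, x)).
Proof.
move=> f0 mf; rewrite /resample [LHS]integral_kcomp//.
apply: eq_integral => x _; rewrite [LHS]integral_dirac// diracT mul1e//.
Qed.

Lemma resample_prob k w : resample k w setT = 1.
Proof.
rewrite -[LHS]mul1e -integral_cst// integral_resample//.
by rewrite integral_cst//= mul1e prob_kernel.
Qed.

HB.instance Definition _ k :=
  Kernel_isProbability.Build _ _ _ _ _ (resample k) (resample_prob k).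

(** [run n j] is the law of the sequence obtained from a given one by drawing the
coordinates [j.+1], ..., [j + n] afresh, in this order. *)
Fixpoint run (n j : nat) : R.-spker S ~> S :=
  match n with
  | 0 => kdirac (@measurable_id _ S setT)
  | n'.+1 => mkcomp_noparam (resample j) (run n' j.+1)
  end.

Lemma run0 j w A : run 0 j w A = (\1_A w)%:E.
Proof. by []. Qed.

Lemma runS n j w A : measurable A ->
  run n.+1 j w A = \int[kappa j w]_x run n j.+1 (update j.+1 (w, x)) A.
Proof.
move=> mA; rewrite -(@integral_resample j w (fun z => run n j.+1 z A))//.
exact: measurable_kernel.
Qed.

Lemma run_prob n j w : run n j w setT = 1.
Proof.
elim: n j w => [|n IH] j w; first by rewrite run0 indicT.
rewrite runS//; under eq_integral do rewrite IH.
by rewrite integral_cst// mul1e prob_kernel.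
Qed.

Lemma integral_runSr n j w (f : S -> \bar R) : (forall z, 0 <= f z) ->
  measurable_fun setT f ->
  \int[run n.+1 j w]_z f z = \int[run n j w]_y \int[resample (j + n) y]_z f z.
Proof.
move=> f0 mf; have mh k : measurable_fun setT (fun y => \int[resample k y]_z f z).
  by apply: measurable_fun_integral_kernel => // U mU; exact: measurable_kernel.
elim: n j w => [|n IH] j w.
  rewrite [LHS]integral_mkcomp_noparam//.
  rewrite [RHS]integral_dirac// diracT mul1e addn0.
  by apply: eq_integral => y _; rewrite [LHS]integral_dirac// diracT mul1e.
rewrite [LHS]integral_mkcomp_noparam//.
under eq_integral do rewrite IH.
rewrite [RHS]integral_mkcomp_noparam ?addnS//.
by move=> y; exact: integral_ge0.
Qed.

Lemma update_agree j (w : S) x i : (i <= j)%N -> update j.+1 (w, x) i = w i.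
Proof. by move=> ij; rewrite /update ltn_eqF. Qed.

(** An event decided by the present coordinates is not affected by drawing the
later ones. *)
Lemma run_past n j w A : measurable A -> determined_by j A ->
  run n j w A = (\1_A w)%:E.
Proof.
elim: n j w => // n IH j w mA dA.
rewrite runS// (eq_integral (cst (\1_A w)%:E)); last first.
  move=> x _; rewrite IH//; last exact: determined_byW dA.
  congr (_ %:E); rewrite !indicE; congr (_%:R); congr nat_of_bool.
  apply/idP/idP; rewrite !inE; apply: dA => i ij; by rewrite update_agree.
by rewrite integral_cst// prob_kernel mule1.
Qed.

Lemma run_stable n m j w A : measurable A -> determined_by (j + n) A ->
  run (n + m) j w A = run n j w A.
Proof.
elim: n j w => [|n IH] j w mA dA.
  by rewrite addn0 in dA; rewrite add0n run_past// run0.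
rewrite addSn !runS//; apply: eq_integral => x _; rewrite IH//.
by rewrite addSnnS.
Qed.

Lemma run_le1 n j w A : measurable A -> run n j w A <= 1.
Proof.
move=> mA; rewrite -(run_prob n j w).
by apply: le_measure; rewrite ?inE.
Qed.

Lemma run_fin_num n j w A : measurable A -> run n j w A \is a fin_num.
Proof.
by move=> mA; rewrite ge0_fin_numE// (le_lt_trans (run_le1 n j w mA))// ltry.
Qed.

Section continuity.
Variable A : nat -> set S.
Variable lev : nat -> nat.
Hypotheses (mA : forall n, measurable (A n)) (levA : forall n, determined_by (lev n) (A n)).
Hypothesis Adec : forall n, A n.+1 `<=` A n.

(** The conditional probability of [A n] when the coordinates up to [j] are those
of [w]: the further coordinates on which [A n] depends are drawn. *)
Let V j n w := run (lev n - j) j w (A n).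

Let VE j n w m : (lev n - j <= m)%N -> run m j w (A n) = V j n w.
Proof.
move=> h; rewrite -(subnKC h) run_stable//.
by apply: (determined_byW _ (@levA n)); rewrite -leq_subLR.
Qed.

Let V_ge0 j n w : 0 <= V j n w. Proof. exact: measure_ge0. Qed.

Let V_le1 j n w : V j n w <= 1. Proof. exact: run_le1. Qed.

Let VS j n w : V j n w = \int[kappa j w]_x V j.+1 n (update j.+1 (w, x)).
Proof.
rewrite -(@VE j n w (lev n - j.+1).+1) ?runS//.
by rewrite subnS; case: (lev n - j)%N.
Qed.

Let V_dec j w : nonincreasing_seq (fun n => V j n w).
Proof.
apply/nonincreasing_seqP => n.
pose m := maxn (lev n - j) (lev n.+1 - j).
rewrite -(@VE j n.+1 w m) ?leq_maxr// -(@VE j n w m) ?leq_maxl//.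
by apply: le_measure; rewrite ?inE//; exact: Adec.
Qed.

Let G j w := limn (fun n => V j n w).

Let V_cvg j w : V j n w @[n --> \oo] --> G j w.
Proof. exact: ereal_nonincreasing_is_cvgn. Qed.

Let G_le j w n : G j w <= V j n w.
Proof.
have /ereal_nonincreasing_cvgn/cvg_lim := V_dec j w.
rewrite /G => -> //; apply: ereal_inf_lbound; by exists n.
Qed.

Let G_ge0 j w : 0 <= G j w.
Proof.
apply: lime_ge; first by apply: cvgP; exact: V_cvg.
exact: nearW.
Qed.

Let mV j n : measurable_fun setT (V j n).
Proof. exact: measurable_kernel. Qed.

Let mVu j n w : measurable_fun setT (fun x => V j.+1 n (update j.+1 (w, x))).
Proof.
apply: (measurableT_comp (mV j.+1 n)).
exact: (measurableT_comp (measurable_update _) (pair1_measurable w)).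
Qed.

Let G_step j w : G j w != 0 -> exists x, G j.+1 (update j.+1 (w, x)) != 0.
Proof.
move=> G0; apply: contrapT => /forallNP h; case/negP: G0; apply/eqP.
have /cvg_lim : V j n w @[n --> \oo] -->
    \int[kappa j w]_x G j.+1 (update j.+1 (w, x)).
  under eq_fun do rewrite VS.
  apply: (@dominated_cvg _ _ _ _ _ measurableT _ _ (cst 1)) => //.
  - apply: (@finite_bounded_integrable _ _ _ _ _ (cst 1%R) 1%R) => //.
      by rewrite prob_kernel ltry.
    by move=> x _; rewrite normr1.
  - by move=> n x _; rewrite gee0_abs.
rewrite -/(G j w) => -> //; apply: integral0_eq => x _.
by have := h x; move=> /negP; rewrite negbK => /eqP.
Qed.

(** The heart of the Ionescu-Tulcea theorem: if the probabilities of a decreasing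
sequence of cylinders do not tend to 0, the coordinates can be chosen one by one
so that this remains true conditionally on the chosen ones, and the sequence so
built lies in every cylinder. *)
Lemma run_continuity w0 : G 0 w0 != 0 -> exists w, forall n, A n w.
Proof.
move=> G0.
have /choice[nxt nxtP] : forall jw : nat * S, exists x,
    G jw.1 jw.2 != 0 -> G jw.1.+1 (update jw.1.+1 (jw.2, x)) != 0.
  move=> [j w] /=; have [_|/G_step[x Gx]] := boolP (G j w == 0).
    by exists point.
  by exists x.
pose W := fix W j := if j is i.+1 then update i.+1 (W i, nxt (i, W i)) else w0.
have GW j : G j (W j) != 0 by elim: j => // j IH; exact: (nxtP (j, W j) IH).
have WE j i : (i <= j)%N -> W j i = W i i.
  elim: j => [|j IH]; first by rewrite leqn0 => /eqP ->.
  rewrite leq_eqVlt => /predU1P[-> //|]; rewrite ltnS => ij.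
  by rewrite -IH//= update_agree.
exists (fun i => W i i) => n; set j := lev n.
apply: (@levA n (W j)) => [i ij|]; first exact: WE.
have : 0 < G j (W j) by rewrite lt0e GW G_ge0.
move=> /lt_le_trans/(_ (G_le j (W j) n)).
rewrite /V subnn run0 lte_fin indicE.
by case: (boolP (_ \in _)); rewrite ?inE// ltxx.
Qed.

End continuity.

Section extension.
Variable w0 : S.
Hypothesis kappa_past : forall k w w' C, (forall i, (i <= k)%N -> w i = w' i) ->
  measurable C -> kappa k w C = kappa k w' C.

Definition cylinder_content (A : set (cylinder_algebra T)) : \bar R :=
  limn (fun n => run n 0 w0 A).

Lemma cylinder_contentE (A : set S) k : measurable A -> determined_by k A ->
  cylinder_content A = run k 0 w0 A.
Proof.
move=> mA dA; apply/cvg_lim => //; apply: cvg_near_cst.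
near=> n; have kn : (k <= n)%N by near: n; exact: nbhs_infty_ge.
by rewrite -(subnKC kn) run_stable.
Unshelve. all: by end_near. Qed.

Let content0 : cylinder_content set0 = 0.
Proof. by rewrite (@cylinder_contentE set0 0%N)//= ?measure0. Qed.

Let content_ge0 A : 0 <= cylinder_content A.
Proof.
rewrite /cylinder_content; have [c|nc] := pselect (cvg (run n 0 w0 A @[n --> \oo])).
  by apply: lime_ge => //; exact: nearW.
by rewrite (dvgP nc).
Qed.

(** Once the sets of a disjoint family are removed from its union one after the
other, what remains decreases to the empty set; so the claim reduces to
[run_continuity]. *)
Let content_semi_sigma_additive : semi_sigma_additive cylinder_content.
Proof.
move=> F mF tF mUF.
have mFS i : measurable (F i : set S) by case: (mF i).
have mUS : measurable ((\bigcup_i F i) : set S) by exact: bigcupT_measurable.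
have /choice[lev levF] : forall i, exists k, determined_by k (F i : set S).
  by move=> i; case: (mF i).
have [levU levUF] := mUF.2.
pose L n := maxn levU (\max_(i < n) lev i).
pose A n : set S := (\bigcup_i F i) `\` \big[setU/set0]_(i < n) F i.
have mA n : measurable (A n).
  by apply: measurableD => //; exact: bigsetU_measurable.
have dbig n : determined_by (L n) (\big[setU/set0]_(i < n) F i : set S).
  rewrite -bigcup_mkord => w w' ww' [i /= ni Fiw]; exists i => //.
  apply: levF Fiw => j ij; apply: ww'; rewrite (leq_trans ij)//.
  by rewrite leq_max (leq_bigmax (Ordinal ni)) orbT.
have dU n : determined_by (L n) (\bigcup_i F i : set S).
  by apply: determined_byW levUF; exact: leq_maxl.
have dA n : determined_by (L n) (A n).
  by apply: determined_byI => //; exact: determined_byC.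
have A_dec n : A n.+1 `<=` A n.
  move=> w [Uw nFw]; split=> // Fw; apply: nFw.
  by rewrite big_ord_recr; left.
have A_empty : ~ exists w, forall n, A n w.
  move=> [w Aw]; have [[i _ Fiw] _] := Aw 0%N.
  by have [_] := Aw i.+1; apply; rewrite big_ord_recr/=; right.
have A0 : cylinder_content (A n) @[n --> \oo] --> 0.
  pose V n := run (L n - 0) 0 w0 (A n).
  have -> : (fun n => cylinder_content (A n)) = V.
    by apply/funext => n; rewrite /V subn0; exact: cylinder_contentE.
  have Vdec : nonincreasing_seq V.
    apply/nonincreasing_seqP => n; rewrite /V !subn0.
    rewrite -(@cylinder_contentE (A n) (L n))//.
    rewrite (@cylinder_contentE (A n) (L n.+1))//.
      by apply: le_measure; rewrite ?inE//; exact: A_dec.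
    apply: determined_byW (dA n); rewrite /L geq_max leq_maxl/=.
    by rewrite leq_max big_ord_recr/= leq_maxl orbT.
  have /eqP <- : limn V == 0.
    by apply/negP => /negP/(run_continuity mA dA A_dec)/A_empty.
  exact: ereal_nonincreasing_is_cvgn.
have split_n n : \sum_(0 <= i < n) cylinder_content (F i) =
    cylinder_content (\bigcup_i F i) - cylinder_content (A n).
  rewrite (@cylinder_contentE (\bigcup_i F i) (L n))//.
  rewrite (@cylinder_contentE (A n) (L n))//.
  have -> : \sum_(0 <= i < n) cylinder_content (F i) =
      run (L n) 0 w0 (\big[setU/set0]_(i < n) F i).
    rewrite measure_bigsetU// big_mkord; apply: eq_bigr => i _.
    apply: cylinder_contentE => //; apply: determined_byW (levF i).
    by rewrite leq_max (leq_bigmax i) orbT.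
  rewrite /A measureD//; last 2 first.
  - exact: bigsetU_measurable.
  - by rewrite (le_lt_trans (run_le1 _ _ _ _))// ltry.
  rewrite setIidr; last by rewrite -bigcup_mkord => w [i _ Fiw]; exists i.
  set a := run _ _ _ (\bigcup_i F i); set b := run _ _ _ _.
  have fa : a \is a fin_num by exact: run_fin_num.
  have fb : b \is a fin_num by apply: run_fin_num; exact: bigsetU_measurable.
  by rewrite fin_num_oppeB// addeA subee// add0e.
under eq_fun do rewrite split_n.
suff : cylinder_content (\bigcup_i F i) - cylinder_content (A n) @[n --> \oo] -->
    cylinder_content (\bigcup_i F i) - 0 by rewrite sube0.
by apply: cvgeB => //; [exact: fin_num_adde_defl|exact: cvg_cst].
Qed.

HB.instance Definition _ := isMeasure.Build _ _ _
  cylinder_content content0 content_ge0 content_semi_sigma_additive.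

Definition trajectory_law (A : set S) : \bar R :=
  measure_extension cylinder_content A.

Let measurable_extension (A : set S) : measurable A ->
  measurable (A : set (g_sigma_algebraType (@measurable _ (cylinder_algebra T)))).
Proof.
move: A; apply: smallest_sub; first exact: sigma_algebra_measurable.
move=> A [k [B [mB ->]]]; apply: sub_sigma_algebra; split.
  by rewrite -[X in measurable X]setTI; exact: measurable_coordinate.
by exists k => w w' /(_ k (leqnn k)) /= ->.
Qed.

Let law0 : trajectory_law set0 = 0.
Proof. exact: measure0. Qed.

Let law_ge0 A : 0 <= trajectory_law A.
Proof. exact: measure_ge0. Qed.

Let law_semi_sigma_additive : semi_sigma_additive trajectory_law.
Proof.
move=> F mF tF mUF; apply: measure_semi_sigma_additive => //.
  by move=> i; exact: measurable_extension.
exact: measurable_extension.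
Qed.

HB.instance Definition _ := isMeasure.Build _ _ _
  trajectory_law law0 law_ge0 law_semi_sigma_additive.

Lemma trajectory_lawE (A : set S) k : measurable A -> determined_by k A ->
  trajectory_law A = run k 0 w0 A.
Proof.
move=> mA dA; rewrite -(cylinder_contentE mA dA).
by apply: measurable_mu_extE; split=> //; exists k.
Qed.

Let law_prob : trajectory_law setT = 1.
Proof. by rewrite (@trajectory_lawE setT 0)// run_prob. Qed.

HB.instance Definition _ := Measure_isProbability.Build _ _ _
  trajectory_law law_prob.

(** Such an [f] factors through [truncate k], and the images of the two measures
under [truncate k] agree because its preimages are cylinders. *)
Lemma integral_trajectory_law k (f : S -> \bar R) : (forall w, 0 <= f w) ->
  measurable_fun setT f ->
  (forall w w' : S, (forall i, (i <= k)%N -> w i = w' i) -> f w = f w') ->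
  \int[trajectory_law]_w f w = \int[run k 0 w0]_w f w.
Proof.
move=> f0 mf fk.
have fE w : f w = f (truncate k w).
  by apply: fk => i ik; rewrite /truncate ik.
have mt := @measurable_truncate _ T k.
have push (m : {measure set S -> \bar R}) :
    \int[m]_w f w = \int[pushforward m (truncate k)]_w f w.
  rewrite (ge0_integral_pushforward mt)// preimage_setT.
  by apply: eq_integral => w _; exact: fE.
rewrite (push trajectory_law) (push (run k 0 w0)).
apply: eq_measure_integral => A mA _; apply: trajectory_lawE.
  by rewrite -[X in measurable X]setTI; exact: mt.
exact: determined_by_truncate.
Qed.

Lemma trajectory_law_init B : measurable B ->
  trajectory_law [set w : S | B (w 0%N)] = (\1_B (w0 0%N))%:E.
Proof.
move=> mB; rewrite (@trajectory_lawE _ 0)//.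
  by rewrite -[X in measurable X]setTI; exact: measurable_coordinate.
by move=> w w' /(_ 0%N (leqnn 0)) /= ->.
Qed.

(** The event on the left involves finitely many coordinates, so that its
probability is a [run] probability; its last draw gives [kappa k w C]. *)
Lemma trajectory_law_next k A C : measurable A -> determined_by k A -> measurable C ->
  trajectory_law [set w : S | A w /\ C (w k.+1)] =
  \int[trajectory_law]_(w in A) kappa k w C.
Proof.
move=> mA dA mC; pose f w := (\1_A w)%:E * kappa k w C.
have mE : measurable [set w : S | A w /\ C (w k.+1)].
  apply: measurableI => //.
  by rewrite -[X in measurable X]setTI; exact: measurable_coordinate.
have mf : measurable_fun setT f.
  apply: emeasurable_funM; last exact: measurable_kernel.
  by apply/measurable_EFinP; exact: measurable_indic.
transitivity (\int[run k 0 w0]_w f w); last first.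
  rewrite -integral_trajectory_law//.
  - rewrite [RHS]integral_mkcond; apply: eq_integral => w _.
    by rewrite /f patchE indicE; case: (boolP (w \in A)) => _; rewrite ?mul1e ?mul0e.
  - by move=> w; rewrite mule_ge0// lee_fin.
  - move=> w w' ww'; rewrite /f (kappa_past ww' mC); congr (_ %:E * _).
    rewrite !indicE; congr (_%:R); congr nat_of_bool.
    by apply/idP/idP; rewrite !inE; apply: dA => i /ww'.
rewrite (@trajectory_lawE _ k.+1)//; last first.
  move=> w w' ww' [Aw Cw]; split; last by rewrite -ww'.
  by apply: dA Aw => i ik; apply: ww'; exact: leqW.
set E := [set w : S | _] in mE *.
have m1E : measurable_fun setT (fun w : S => (\1_E w)%:E : \bar R).
  by apply/measurable_EFinP; exact: measurable_indic.
have -> : run k.+1 0 w0 E = \int[run k.+1 0 w0]_w (\1_E w)%:E.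
  by rewrite integral_indic// setIT.
rewrite [LHS]integral_runSr//.
apply: eq_integral => w _; rewrite [LHS]integral_resample//.
rewrite /f (eq_integral (fun x => (\1_A w)%:E * (\1_C x)%:E)); last first.
  move=> x _; rewrite -EFinM !indicE -natrM mulnb; congr (_%:R%:E).
  congr nat_of_bool; rewrite add0n.
  have Aw : A (update k.+1 (w, x)) <-> A w.
    by split; apply: dA => i ik; rewrite update_agree.
  apply/idP/andP; rewrite !inE /E/= /update eqxx/=.
    by case=> /Aw.
  by case=> /Aw.
rewrite ge0_integralZl//; last first.
  by apply/measurable_EFinP; exact: measurable_indic.
by rewrite integral_indic// setIT add0n.
Qed.

End extension.

End trajectories.

(** * Mixtures of kernels *)

Section killed_kernel.
Context d d' (X : measurableType d) (Y : measurableType d') (R : realType).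
Variables (k : R.-spker X ~> Y) (D : set X).
Hypothesis mD : measurable D.
Local Open Scope ereal_scope.

Definition killed (_ : measurable D) (x : X) : {measure set Y -> \bar R} :=
  if x \in D then k x else mzero.

Local Notation kD := (killed mD).

Lemma killedE U : kD^~ U = (k^~ U) \_ D.
Proof. by apply/funext => x; rewrite /killed patchE; case: ifP. Qed.

Let measurable_killed U : measurable U -> measurable_fun setT (kD^~ U).
Proof.
move=> mU; rewrite killedE; apply: (measurable_restrictT _ mD).1.
by apply: measurable_funTS; exact: measurable_kernel.
Qed.

HB.instance Definition _ := isKernel.Build _ _ X Y R kD measurable_killed.

Let killed_le1 : ereal_sup [set kD x setT | x in [set: X]] <= 1.
Proof.
apply: ge_ereal_sup => _ [x _ <-]; rewrite /killed.
by case: ifP => _; [exact: sprob_kernel_le1|exact: lee01].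
Qed.

HB.instance Definition _ := Kernel_isSubProbability.Build _ _ _ _ R kD killed_le1.

Lemma integral_killed (f : Y -> \bar R) :
  (fun x => \int[kD x]_y f y) = (fun x => \int[k x]_y f y) \_ D.
Proof.
by apply/funext => x; rewrite /killed patchE; case: ifP => // _; exact: integral_measure_zero.
Qed.

End killed_kernel.

Section constant_kernel.
Context d (Y : measurableType d) (R : realType).
Variable P : probability Y R.

Definition constant_kernel (_ : unit) : {measure set Y -> \bar R} := P.

HB.instance Definition _ := isKernel.Build _ _ unit Y R
  constant_kernel (fun U mU => measurable_cst (P U)).

HB.instance Definition _ := Kernel_isProbability.Build _ _ _ _ R
  constant_kernel (fun=> probability_setT P).

End constant_kernel.

(** Composing kernels turns an iterated integral into an integral against one
measure, and killing them outside [D] restricts the outer integral; so it is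
enough to compare two measures. *)
Lemma eq_integral_mixture d d' (W : measurableType d) (Y : measurableType d')
    (R : realType) (P : probability W R) (a b : R.-spker W ~> Y) (D : set W)
    (f : Y -> \bar R) : measurable D ->
  (forall U, measurable U ->
    (\int[P]_(w in D) a w U = \int[P]_(w in D) b w U)%E) ->
  (forall y, (0 <= f y)%E) -> measurable_fun setT f ->
  (\int[P]_(w in D) \int[a w]_y f y = \int[P]_(w in D) \int[b w]_y f y)%E.
Proof.
move=> mD ab f0 mf; pose Pk := constant_kernel P.
have mix (c : R.-spker W ~> Y) : (\int[P]_(w in D) \int[c w]_y f y =
    \int[mkcomp_noparam Pk (killed c mD) tt]_y f y)%E.
  rewrite [RHS]integral_mkcomp_noparam// [LHS]integral_mkcond; apply: eq_integral => w _.
  by rewrite -(integral_killed c mD f).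
rewrite !mix; apply: eq_measure_integral => U mU _.
have mixU (c : R.-spker W ~> Y) :
    (mkcomp_noparam Pk (killed c mD) tt U = \int[P]_(w in D) c w U)%E.
  rewrite [RHS]integral_mkcond; apply: eq_integral => w _.
  by rewrite -(killedE c mD U).
by rewrite !mixU ab.
Qed.

Lemma ge0_integral_mrestr d (T : measurableType d) (R : realType)
    (mu : {measure set T -> \bar R}) (D : set T) (mD : measurable D)
    (f : T -> \bar R) : measurable_fun setT f -> (forall x, (0 <= f x)%E) ->
  (\int[mrestr mu mD]_x f x = \int[mu]_(x in D) f x)%E.
Proof.
move=> mf f0.
rewrite (@ge0_negligible_integral _ _ _ _ setT (~` D))//; last 2 first.
- exact: measurableC.
- by rewrite /= /mrestr setICl measure0.
rewrite setTD setCK; apply: eq_measure_integral => A mA AD.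
by rewrite /= /mrestr setIidl.
Qed.

(** * The law of the game *)

Section game_coordinates.
Context {R : realType} {n : nat}.
Local Notation X := 'rV[R]_n.

Lemma measurable_game_coordinate k :
  measurable_fun setT (fun w : game_sequence R n => w k).
Proof. exact: (@measurable_coordinate _ (X * 'I_3)%type k). Qed.

Lemma measurable_game_position k :
  measurable_fun setT (fun w : game_sequence R n => (w k).1).
Proof. exact: (measurableT_comp measurable_fst (measurable_game_coordinate k)). Qed.

Lemma measurable_game_toss k :
  measurable_fun setT (fun w : game_sequence R n => (w k).2).
Proof. exact: (measurableT_comp measurable_snd (measurable_game_coordinate k)). Qed.

Lemma measurable_history_of k : measurable_fun setT (@history_of R n k).
Proof.
apply: measurable_fun_pair.
  apply/measurable_fun_tnthP => i.
  rewrite (_ : _ \o _ = fun w : game_sequence R n => (w i).1).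
    exact: measurable_game_position.
  by apply/funext => w /=; rewrite tnth_mktuple.
apply/measurable_fun_tnthP => i.
rewrite (_ : _ \o _ = fun w : game_sequence R n => (w i).2).
  exact: measurable_game_toss.
by apply/funext => w /=; rewrite tnth_mktuple.
Qed.

End game_coordinates.

Section rounds.
Context {R : realType} {n : nat}.
Variables (Omega : set 'rV[R]_n) (eps alpha beta : R).
Hypotheses (n_gt0 : (0 < n)%N) (eps_gt0 : 0 < eps).
Hypothesis dOmega : domain Omega.
Hypotheses (alpha_gt0 : 0 < alpha) (beta_gt0 : 0 < beta)
  (alphaDbeta : alpha + beta = 1).
Variables S1 S2 : strategy R n.
Arguments S1 : clear implicits.
Arguments S2 : clear implicits.
Hypotheses (mS1 : forall k, measurable_fun setT (S1 k))
  (mS2 : forall k, measurable_fun setT (S2 k)).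

Local Notation lambda := (lebesgue_rV R n).
Local Notation X := 'rV[R]_n.
Local Notation toss := (toss_prob alpha beta).

Lemma measurable_current k : measurable_fun setT (@current R n k).
Proof. exact: (measurableT_comp (measurable_tnth _) measurable_fst). Qed.

Let volume_inv_ge0 (x : X) : 0 <= (ball_volume eps x)^-1.
Proof. by rewrite invr_ge0 ltW// ball_volume_gt0. Qed.

Definition uniform_measure (x : X) : {measure set X -> \bar R} :=
  mscale (NngNum (volume_inv_ge0 x)) (mrestr lambda (measurable_eball x eps)).

Lemma uniform_measureE x B : uniform_measure x B =
  (((ball_volume eps x)^-1)%:E * lambda (B `&` eball x eps))%E.
Proof. by []. Qed.

Definition move_measure (c : 'I_3) k (h : history R n k) : {measure set X -> \bar R} :=
  if `[< Omega (current h) >] then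
    match val c with
    | 0 => (\d_(S1 k h) : {measure set X -> \bar R})
    | 1 => (\d_(S2 k h) : {measure set X -> \bar R})
    | _ => uniform_measure (current h)
    end
  else (\d_(current h) : {measure set X -> \bar R}).

Lemma move_measureE c k (h : history R n k) B :
  move_measure c h B = move_law Omega eps S1 S2 c h B.
Proof.
by rewrite /move_measure /move_law; case: ifP => // _; case: (val c) => [|[|]].
Qed.

Lemma uniform_measureT x : uniform_measure x setT = 1%E.
Proof.
rewrite uniform_measureE setTI.
rewrite -(ball_volumeE eps_gt0) -EFinM mulVf// gt_eqF//.
exact: ball_volume_gt0.
Qed.

Lemma move_measureT c k (h : history R n k) : move_measure c h setT = 1%E.
Proof.
rewrite /move_measure; case: ifP => _; last exact: diracT.
by case: (val c) => [|[|_]]; [exact: diracT|exact: diracT|exact: uniform_measureT].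
Qed.

Lemma measurable_uniform_measure B : measurable B ->
  measurable_fun setT (fun x => uniform_measure x B).
Proof.
move=> mB.
have fB x : (lambda (B `&` eball x eps) < +oo)%E.
  apply: (@le_lt_trans _ _ (lambda (eball x eps))); last exact: eball_finite.
  apply: le_measure; rewrite ?inE; last exact: subIsetr.
    by apply: measurableI => //; exact: measurable_eball.
  exact: measurable_eball.
rewrite (_ : (fun x => uniform_measure x B) = EFin \o ball_average eps \1_B).
  apply/measurable_EFinP; apply: (@measurable_ball_average _ _ _ n_gt0 eps_gt0 _ 1).
    exact: measurable_indic.
  by move=> y; rewrite indicE; case: (y \in B); rewrite ?normr1 ?normr0.
apply/funext => x; rewrite uniform_measureE /ball_average /= EFinM.
congr (_ * _)%E; rewrite /Rintegral integral_indic//; last exact: measurable_eball.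
by rewrite fineK// ge0_fin_numE.
Qed.

Lemma measurable_dirac_comp d (T : measurableType d) (f : T -> X) B :
  measurable_fun setT f -> measurable B ->
  measurable_fun setT (fun t => \d_(f t) B : \bar R).
Proof.
move=> mf mB; apply/measurable_EFinP.
exact: (measurableT_comp (measurable_indic mB) mf).
Qed.

Lemma measurable_move_measure c k B : measurable B ->
  measurable_fun setT (fun h : history R n k => move_measure c h B).
Proof.
move=> mB; pose D := (@current R n k) @^-1` Omega.
have mD : measurable D.
  by rewrite -[X in measurable X]setTI; apply: measurable_current => //; exact: measurable_domain.
have mcur : measurable_fun setT (fun h : history R n k => \d_(current h) B : \bar R).
  exact: measurable_dirac_comp (@measurable_current k) mB.
rewrite (_ : (fun h => _) = fun h : history R n k => if h \in D then
    match val c with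
    | 0 => \d_(S1 k h) B
    | 1 => \d_(S2 k h) B
    | _ => uniform_measure (current h) B
    end else \d_(current h) B).
  apply: measurable_fun_ifT => //.
    apply: (measurable_fun_bool true); rewrite setTI (_ : _ @^-1` _ = D)//.
    apply/seteqP; split => h; first by move=> hD; apply: set_mem.
    by move=> hD; exact: mem_set hD.
  case: (val c) => [|[|_]]; [exact: measurable_dirac_comp (@mS1 k) mB|exact: measurable_dirac_comp (@mS2 k) mB|].
  exact: (measurableT_comp (measurable_uniform_measure mB) (@measurable_current k)).
apply/funext => h; rewrite /move_measure.
have -> : (h \in D) = `[< Omega (current h) >] by [].
by case: ifP => // _; case: (val c) => [|[|]].
Qed.

Lemma toss_ge0 c : 0 <= toss c.
Proof.
by rewrite /toss_prob; case: (val c) => [|[|[|?]]]; rewrite ?divr_ge0// ltW.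
Qed.

Lemma toss_inord k : (k < 3)%N -> toss (inord k) = if k is 2 then beta else alpha / 2.
Proof. by move=> k3; rewrite /toss_prob -[val _]/(nat_of_ord _) inordK. Qed.

Lemma sum_toss : \sum_(c < 3) toss (inord c) = 1.
Proof.
rewrite !big_ord_recr big_ord0 /= !toss_inord//= add0r.
by rewrite -[RHS]alphaDbeta; field.
Qed.

Lemma measurable_tag (c : 'I_3) : measurable_fun setT (fun x : X => (x, c)).
Proof. exact: pair2_measurable. Qed.

(** The law of the pair formed by the next position and the toss that leads to
it. *)
Definition round_law k (h : history R n k) : {measure set (X * 'I_3) -> \bar R} :=
  msum (fun c : nat => mscale (NngNum (toss_ge0 (inord c)))
    (measure_function_pushforward__canonical__measure_function_Measure
      (move_measure (inord c) h) (measurable_tag (inord c)))) 3.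

Lemma round_lawE k (h : history R n k) U :
  round_law h U = (\sum_(c < 3) (toss (inord c))%:E *
    move_measure (inord c) h [set x | U (x, inord c)])%E.
Proof. by []. Qed.

Lemma measurable_round_law k U : measurable U ->
  measurable_fun setT (fun h : history R n k => round_law h U).
Proof.
move=> mU; under eq_fun do rewrite round_lawE.
apply: emeasurable_sum => c; apply: measurable_funeM.
apply: measurable_move_measure.
by rewrite -[X in measurable X]setTI; exact: measurable_tag.
Qed.

HB.instance Definition _ k := isKernel.Build _ _ (history R n k) (X * 'I_3)%type R
  (@round_law k) (@measurable_round_law k).

Let round_law_prob k (h : history R n k) : round_law h setT = 1%E.
Proof.
rewrite round_lawE; under eq_bigr do rewrite move_measureT mule1.
by rewrite sumEFin sum_toss.
Qed.

HB.instance Definition _ k := Kernel_isProbability.Build _ _ _ _ R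
  (@round_law k) (@round_law_prob k).

Lemma round_law_rectangle k (h : history R n k) (c : 'I_3) B :
  round_law h [set xc | B xc.1 /\ xc.2 = c] =
  ((toss c)%:E * move_law Omega eps S1 S2 c h B)%E.
Proof.
rewrite round_lawE (bigD1 c)//= inord_val -move_measureE.
rewrite (_ : [set x | _] = B); last by apply/seteqP; split => x //= [].
rewrite big1 ?adde0// => c' cc'.
rewrite (_ : [set x | _] = set0) ?measure0 ?mule0//.
by apply/seteqP; split => x //= [_ /esym/eqP]; rewrite inord_val eq_sym (negbTE cc').
Qed.

Section existence.
Variable x0 : X.
Local Notation Z := (sequence_space (X * 'I_3)%type).

(** Trajectories pair each position with the toss that led to it; game sequences
pair it with the next toss. *)
Definition shift_tosses (z : Z) : game_sequence R n := fun k => ((z k).1, (z k.+1).2).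

Definition trajectory_history k (z : Z) : history R n k := history_of k (shift_tosses z).

Lemma measurable_position k : measurable_fun setT (fun z : Z => (z k).1).
Proof. exact: (measurableT_comp measurable_fst (measurable_coordinate k)). Qed.

Lemma measurable_toss k : measurable_fun setT (fun z : Z => (z k).2).
Proof. exact: (measurableT_comp measurable_snd (measurable_coordinate k)). Qed.

Lemma measurable_shift_tosses : measurable_fun setT shift_tosses.
Proof.
apply: (@measurable_to_sequences _ (X * 'I_3)%type _ Z shift_tosses) => k.
apply: measurable_fun_pair; first exact: measurable_position.
exact: measurable_toss.
Qed.

Lemma measurable_trajectory_history k : measurable_fun setT (@trajectory_history k).
Proof. exact: (measurableT_comp (@measurable_history_of R n k) measurable_shift_tosses). Qed.

Lemma trajectory_history_past k (z z' : Z) : (forall i, (i <= k)%N -> z i = z' i) ->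
  trajectory_history k z = trajectory_history k z'.
Proof.
move=> zz'; congr (_, _); apply: eq_mktuple => i /=; rewrite zz'//.
by rewrite -ltnS.
Qed.

Definition next_law k (z : Z) : {measure set (X * 'I_3) -> \bar R} :=
  round_law (trajectory_history k z).

Let measurable_next_law k U : measurable U ->
  measurable_fun setT (fun z => next_law k z U).
Proof.
move=> mU; apply: (measurableT_comp (measurable_round_law (k := k) mU)).
exact: measurable_trajectory_history.
Qed.

HB.instance Definition _ k := isKernel.Build _ _ Z (X * 'I_3)%type R
  (next_law k) (@measurable_next_law k).

Let next_law_prob k z : next_law k z setT = 1%E.
Proof. exact: prob_kernel. Qed.

HB.instance Definition _ k := Kernel_isProbability.Build _ _ _ _ R
  (next_law k) (@next_law_prob k).

Let next_law_past k (z z' : Z) C : (forall i, (i <= k)%N -> z i = z' i) ->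
  measurable C -> next_law k z C = next_law k z' C.
Proof. by move=> zz' _; rewrite /next_law (trajectory_history_past zz'). Qed.

Let start : Z := fun=> (x0, ord0).

Let Q : probability Z R := trajectory_law (fun k => next_law k) start.

Definition game_measure : set (game_sequence R n) -> \bar R :=
  pushforward Q shift_tosses.

HB.instance Definition _ := Measure.copy game_measure
  (measure_function_pushforward__canonical__measure_function_Measure
    Q measurable_shift_tosses).

Let game_measure_prob : game_measure setT = 1%E.
Proof. by rewrite /game_measure /pushforward preimage_setT probability_setT. Qed.

HB.instance Definition _ := Measure_isProbability.Build _ _ _
  game_measure game_measure_prob.

Lemma measurable_set1_rV (x : X) : measurable [set x].
Proof.
rewrite -(setCK [set x]); apply: measurableC; apply: open_measurable_mx.
rewrite openC; apply: accessible_closed_set1.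
by apply: hausdorff_accessible; exact: norm_hausdorff.
Qed.

(** Given the past, the pair of the next toss and the next position is drawn from
[round_law], whose mass on rectangles is the prescribed one. *)
Lemma game_measure_is_law : is_game_law Omega eps alpha beta x0 S1 S2 game_measure.
Proof.
split.
  transitivity (Q [set z : Z | [set xc | xc.1 = x0] (z 0%N)]); first by [].
  have mx0 : measurable [set xc : X * 'I_3 | xc.1 = x0].
    rewrite (_ : [set xc | _] = [set x0] `*` setT).
      by apply: measurableX => //; exact: measurable_set1_rV.
    by apply/seteqP; split => -[x c] //= [].
  rewrite [LHS](trajectory_law_init (fun k => next_law k) start mx0).
  by rewrite indicE mem_set.
move=> k H c B mH mB.
have mA : measurable ((@trajectory_history k) @^-1` H).
  by rewrite -[X in measurable X]setTI; exact: measurable_trajectory_history.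
transitivity (Q [set z : Z | H (trajectory_history k z) /\
    [set xc | B xc.1 /\ xc.2 = c] (z k.+1)]).
  apply: (congr1 (fun E : set Z => Q E)).
  by apply/seteqP; split => z /=; [case=> ? ? ?|case=> ? [? ?]].
have dA : determined_by k ((@trajectory_history k) @^-1` H).
  by move=> z z' /trajectory_history_past zz' /=; rewrite zz'.
have mC : measurable [set xc : X * 'I_3 | B xc.1 /\ xc.2 = c].
  rewrite (_ : [set xc | _] = B `*` [set c]); first exact: measurableX.
  by apply/seteqP; split => -[].
rewrite [LHS](@trajectory_law_next _ _ _ (fun k => next_law k) start next_law_past k
   ((@trajectory_history k) @^-1` H) _ mA dA mC).
rewrite [RHS](ge0_integral_pushforward measurable_shift_tosses); last 3 first.
- by rewrite -[X in measurable X]setTI; exact: measurable_history_of.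
- apply: measurable_funTS.
  rewrite (_ : (fun w => _) = fun w => round_law (history_of k w)
      [set xc | B xc.1 /\ xc.2 = c]).
    by apply: (measurableT_comp (measurable_round_law mC)); exact: measurable_history_of.
  by apply/funext => w; rewrite round_law_rectangle.
- by move=> w _; rewrite -round_law_rectangle.
by apply: eq_integral => z _; rewrite /= -round_law_rectangle.
Qed.

End existence.

(** * The mean of a function after one round *)

Lemma game_law_is_law x0 :
  is_game_law Omega eps alpha beta x0 S1 S2
    (game_law Omega eps alpha beta x0 S1 S2).
Proof.
apply: (getPex (P := [set P | is_game_law Omega eps alpha beta x0 S1 S2 P])).
by exists (game_measure x0 : probability (game_sequence R n) R); exact: game_measure_is_law.
Qed.

Section one_step.
Variables (x0 : X) (P : probability (game_sequence R n) R).
Hypothesis PE : is_game_law Omega eps alpha beta x0 S1 S2 P.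
Variables (k : nat) (H : set (history R n k)).
Hypothesis mH : measurable H.

Let D := (@history_of R n k) @^-1` H.

Let mD : measurable D.
Proof. by rewrite -[X in measurable X]setTI; exact: measurable_history_of. Qed.

Definition round (w : game_sequence R n) : X * 'I_3 := ((w k.+1).1, (w k).2).

Lemma measurable_round : measurable_fun setT round.
Proof.
apply: measurable_fun_pair; first exact: measurable_game_position.
exact: measurable_game_toss.
Qed.

Definition law_of_next (w : game_sequence R n) : {measure set (X * 'I_3) -> \bar R} :=
  round_law (history_of k w).

Let measurable_law_of_next U : measurable U ->
  measurable_fun setT (fun w => law_of_next w U).
Proof.
move=> mU; apply: (measurableT_comp (measurable_round_law (k := k) mU)).
exact: measurable_history_of.
Qed.

HB.instance Definition _ := isKernel.Build _ _ (game_sequence R n) (X * 'I_3)%type R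
  law_of_next measurable_law_of_next.

Let law_of_next_prob w : law_of_next w setT = 1%E.
Proof. exact: prob_kernel. Qed.

HB.instance Definition _ := Kernel_isProbability.Build _ _ _ _ R
  law_of_next law_of_next_prob.

Lemma law_of_round U : measurable U ->
  (\int[P]_(w in D) round_law (history_of k w) U = P (D `&` round @^-1` U))%E.
Proof.
move=> mU; pose Uc c := [set x | U (x, inord c : 'I_3)].
have mUc c : measurable (Uc c).
  by rewrite -[X in measurable X]setTI; exact: measurable_tag.
pose E c := [set w : game_sequence R n |
  [/\ H (history_of k w), (w k).2 = inord c & Uc c (w k.+1).1]].
have mE c : measurable (E c).
  rewrite (_ : E c = D `&` round @^-1` (Uc c `*` [set inord c])).
    apply: measurableI => //.
    by rewrite -[X in measurable X]setTI; apply: measurable_round => //; exact: measurableX.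
  by apply/seteqP; split => w; [case=> ? ? ?|case=> ? [? ?]].
rewrite (_ : D `&` _ = \big[setU/set0]_(c < 3) E c); last first.
  rewrite -bigcup_mkord; apply/seteqP; split => w /=.
    move=> [Hw Uw]; exists (nat_of_ord (w k).2); first exact: ltn_ord.
    by rewrite /E /Uc /= inord_val.
  by move=> [c _ [Hw wc]]; rewrite /Uc /= -wc.
(* from 3 on, [inord] has the constant value 0, which would break disjointness *)
pose E' c := if (c < 3)%N then E c else set0.
rewrite (_ : \big[setU/set0]_(c < 3) E c = \big[setU/set0]_(c < 3) E' c); last first.
  by apply: eq_bigr => c _; rewrite /E' ltn_ord.
rewrite measure_bigsetU//; last 2 first.
- by move=> c; rewrite /E'; case: ifP.
- apply/trivIsetP => i j _ _ ij; rewrite /E'; case: ltnP => i3; rewrite ?set0I//.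
  case: ltnP => j3; rewrite ?setI0//; apply/seteqP; split => // w [[_ wi _] [_ wj _]].
  by move: ij; rewrite -(inordK i3) -(inordK j3) -wi -wj eqxx.
under eq_integral do rewrite round_lawE.
rewrite ge0_integral_sum//; last 2 first.
- move=> c; apply: measurable_funeM; apply: measurable_funTS.
  apply: (measurableT_comp (measurable_move_measure (inord c) (k := k) (mUc c))).
  exact: measurable_history_of.
- by move=> c w _; rewrite mule_ge0// lee_fin toss_ge0.
apply: eq_bigr => c _; rewrite /E' ltn_ord; apply: etrans (esym (PE.2 k H (inord c) (Uc c) mH (mUc c))).
by apply: eq_integral => w _; rewrite move_measureE.
Qed.

(** The prescribed probabilities of rectangles determine the joint law of the next
position and toss on the event [D]; here it is put in the form of an integral. *)
Lemma integral_round (f : X * 'I_3 -> \bar R) :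
  (forall xc, (0 <= f xc)%E) -> measurable_fun setT f ->
  (\int[P]_(w in D) f (round w) =
   \int[P]_(w in D) \int[round_law (history_of k w)]_xc f xc)%E.
Proof.
move=> f0 mf; have := @eq_integral_mixture _ _ _ _ _ P (kdirac measurable_round)
  law_of_next D f mD _ f0 mf.
move=> <-; last first.
  move=> U mU; rewrite [RHS]law_of_round//.
  rewrite (eq_integral (fun w => (\1_(round @^-1` U) w)%:E)); last first.
    by move=> w _; rewrite /kdirac/= diracE indicE.
  rewrite integral_indic//; first by rewrite setIC.
  by rewrite -[X in measurable X]setTI; exact: measurable_round.
apply: eq_integral => w _; rewrite [RHS]integral_dirac//.
by rewrite diracT mul1e.
Qed.

End one_step.

Definition round_mean (f : X -> R) k (h : history R n k) : R :=
  alpha / 2 * f (S1 k h) + alpha / 2 * f (S2 k h) +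
  beta * ball_average eps f (current h).

Lemma integral_round_law k (h : history R n k) (f : X -> R) (M : R) :
  Omega (current h) -> measurable_fun setT f -> (forall x, 0 <= f x <= M) ->
  (\int[round_law h]_xc (f xc.1)%:E = (round_mean f h)%:E)%E.
Proof.
move=> Oh mf fM; have f0 x : 0 <= f x by case/andP: (fM x).
have mfst : measurable_fun setT (fun xc : X * 'I_3 => (f xc.1)%:E).
  by apply/measurable_EFinP; exact: (measurableT_comp mf measurable_fst).
have mfE : measurable_fun setT (EFin \o f) by exact/measurable_EFinP.
rewrite /round_law ge0_integral_measure_sum//; last by move=> x _; rewrite lee_fin.
have term c : (\int[mscale (NngNum (toss_ge0 (inord c)))
    (measure_function_pushforward__canonical__measure_function_Measure
      (move_measure (inord c) h) (measurable_tag (inord c)))]_xc (f xc.1)%:E =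
    (toss (inord c))%:E * \int[move_measure (inord c) h]_x (f x)%:E)%E.
  rewrite ge0_integral_mscale//; last by move=> x _; rewrite lee_fin.
  congr (_ * _)%E.
  rewrite [LHS](ge0_integral_pushforward (measurable_tag _))//.
  by move=> x _; rewrite lee_fin.
under eq_bigr do rewrite term.
rewrite !big_ord_recr big_ord0 /= add0e !toss_inord// /move_measure asboolT//.
rewrite -![val _]/(nat_of_ord _) !inordK//=.
rewrite [X in (_ * X + _ + _)%E]integral_dirac// diracT mul1e.
rewrite [X in (_ + _ * X + _)%E]integral_dirac// diracT mul1e.
have iB : lambda.-integrable (eball (current h) eps) (EFin \o f).
  by apply: (@integrable_eball _ _ _ eps_gt0 f M) => // y; rewrite ger0_norm//; case/andP: (fM y).
have -> : (\int[uniform_measure (current h)]_x (f x)%:E =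
    (ball_average eps f (current h))%:E)%E.
  rewrite [LHS]ge0_integral_mscale//; last by move=> x _; rewrite lee_fin.
  rewrite ge0_integral_mrestr//.
  rewrite /ball_average EFinM; congr (_ * _)%E.
  by rewrite fineK//; apply: integrable_fin_num => //; exact: measurable_eball.
by rewrite -!EFinM -!EFinD.
Qed.

Lemma round_mean_norm (f : X -> R) (M : R) k (h : history R n k) : measurable_fun setT f ->
  (forall x, `|f x| <= M) -> `|round_mean f h| <= M.
Proof.
move=> mf fM; have a2 : 0 <= alpha / 2 by rewrite divr_ge0// ltW.
have avgM : `|ball_average eps f (current h)| <= M.
  have M0 : 0 <= M by rewrite (le_trans _ (fM point)).
  rewrite ler_norml -{1}(ball_average_cst n_gt0 eps_gt0 (- M) (current h)).
  rewrite -[in X in _ && X](ball_average_cst n_gt0 eps_gt0 M (current h)).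
  apply/andP; split; apply: (@le_ball_average _ _ _ n_gt0 eps_gt0 _ _ M M) => // y;
    rewrite ?normrN ?ger0_norm// => _; by have := fM y; rewrite ler_norml => /andP[].
rewrite [leRHS](_ : _ = alpha / 2 * M + alpha / 2 * M + beta * M); last first.
  by rewrite -[LHS]mul1r -[X in X * _]alphaDbeta; field.
rewrite (le_trans (ler_normD _ _))// lerD//; last first.
  by rewrite normrM gtr0_norm// ler_pM2l.
by rewrite (le_trans (ler_normD _ _))// lerD// normrM ger0_norm// ler_wpM2l.
Qed.

Lemma measurable_round_mean (f : X -> R) (M : R) k : measurable_fun setT f ->
  (forall x, `|f x| <= M) ->
  measurable_fun setT (fun h : history R n k => round_mean f h).
Proof.
move=> mf fM; apply: measurable_funD; last first.
  apply: measurable_funM => //.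
  exact: (measurableT_comp (measurable_ball_average n_gt0 eps_gt0 mf fM) (@measurable_current k)).
apply: measurable_funD; apply: measurable_funM => //.
  exact: (measurableT_comp mf (@mS1 k)).
exact: (measurableT_comp mf (@mS2 k)).
Qed.

Lemma round_meanD (f : X -> R) (M c : R) k (h : history R n k) : measurable_fun setT f ->
  (forall x, `|f x| <= M) -> round_mean (fun x => f x + c) h = round_mean f h + c.
Proof.
move=> mf fM; rewrite /round_mean.
rewrite (@ball_averageD _ _ _ eps_gt0 f (cst c) M `|c|)// ball_average_cst//.
rewrite -[X in _ = _ + X]mul1r -[X in _ = _ + X * _]alphaDbeta.
by field.
Qed.

Section expected_round.
Variables (x0 : X) (P : probability (game_sequence R n) R).
Hypothesis PE : is_game_law Omega eps alpha beta x0 S1 S2 P.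
Variables (k : nat) (H : set (history R n k)).
Hypothesis mH : measurable H.
Hypothesis HO : forall h, H h -> Omega (current h).

Let D := (@history_of R n k) @^-1` H.

Let mD : measurable D.
Proof. by rewrite -[X in measurable X]setTI; exact: measurable_history_of. Qed.

Lemma bounded_game_integrable (f : game_sequence R n -> R) (M : R) :
  measurable_fun setT f -> (forall w, `|f w| <= M) -> P.-integrable D (EFin \o f).
Proof.
move=> mf fM; apply: (@finite_bounded_integrable _ _ _ _ _ _ M) => //.
  by rewrite (le_lt_trans (probability_le1 P mD))// ltry.
exact: measurable_funTS.
Qed.

(** Adding [M] to [f] makes it nonnegative, and [round_mean] commutes with adding
constants because [alpha + beta = 1]. *)
Lemma expected_round (f : X -> R) (M : R) : measurable_fun setT f -> (forall x, `|f x| <= M) ->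
  \int[P]_(w in D) f (w k.+1).1 = \int[P]_(w in D) round_mean f (history_of k w).
Proof.
move=> mf fM; pose g x := f x + M.
have mg : measurable_fun setT g by exact: measurable_funD.
have gM x : 0 <= g x <= M + M.
  have := fM x; rewrite ler_norml => /andP[fM1 fM2].
  by rewrite /g lerD2r fM2 andbT -lerBlDr sub0r.
have eqg : \int[P]_(w in D) g (w k.+1).1 =
    \int[P]_(w in D) round_mean g (history_of k w).
  rewrite /Rintegral; congr fine.
  have m1 : measurable_fun setT (fun xc : X * 'I_3 => (g xc.1)%:E).
    by apply/measurable_EFinP; exact: (measurableT_comp mg measurable_fst).
  have g0 (xc : X * 'I_3) : (0 <= (g xc.1)%:E)%E.
    by rewrite lee_fin; case/andP: (gM xc.1).
  have := integral_round PE mH g0 m1; rewrite /= => ->.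
  apply: eq_integral => w; rewrite inE => Hw.
  exact: (integral_round_law (HO Hw) mg gM).
have mf1 : measurable_fun setT (fun w : game_sequence R n => f (w k.+1).1).
  exact: (measurableT_comp mf (measurable_game_position k.+1)).
have mf2 : measurable_fun setT (fun w : game_sequence R n => round_mean f (history_of k w)).
  exact: (measurableT_comp (measurable_round_mean mf fM) (@measurable_history_of R n k)).
have iM : P.-integrable D (EFin \o cst M).
  exact: (@bounded_game_integrable _ `|M|).
move: eqg; rewrite /g; under [X in _ = X -> _]eq_Rintegral do rewrite (round_meanD _ _ mf fM).
rewrite RintegralD//; last by exact: (bounded_game_integrable mf1 (fun w => fM _)).
rewrite RintegralD//; last first.
  by apply: (@bounded_game_integrable _ M mf2) => w; exact: round_mean_norm.
exact: addIr.
Qed.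

End expected_round.

End rounds.

(** * Stopping at the exit from the domain *)

Lemma Rintegral_probability_cst d (W : measurableType d) (R : realType)
    (P : probability W R) (r : R) : \int[P]_w (cst r w) = r.
Proof.
rewrite Rintegral_cst// -[RHS]mulr1; congr (_ * _).
exact: (congr1 fine (probability_setT P)).
Qed.

Lemma le_Rintegral_event d (W : measurableType d) (R : realType)
    (P : probability W R) (G : set W) (f g : W -> R) (M : R) :
  measurable G -> P G = 1%E -> measurable_fun setT f -> measurable_fun setT g ->
  (forall w, `|f w| <= M) -> (forall w, `|g w| <= M) ->
  (forall w, G w -> f w <= g w) -> \int[P]_w f w <= \int[P]_w g w.
Proof.
move=> mG PG mf mg fM gM fg.
have int (h : W -> R) : measurable_fun setT h -> (forall w, `|h w| <= M) ->
    P.-integrable setT (EFin \o h).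
  move=> mh hM; apply: (@finite_bounded_integrable _ _ _ _ _ _ M) => //.
  by rewrite (le_lt_trans (probability_le1 P measurableT))// ltry.
have PN : P (~` G) = 0%E by rewrite probability_setC// PG subee.
have onG (h : W -> R) : measurable_fun setT h -> (forall w, `|h w| <= M) ->
    \int[P]_w h w = \int[P]_(w in G) h w.
  move=> mh hM; rewrite /Rintegral; congr fine.
  rewrite (@negligible_integral _ _ _ _ setT (~` G))//; last 2 first.
  - exact: measurableC.
  - exact: int.
  by rewrite setTD setCK.
rewrite !onG//; apply: le_Rintegral => //.
- by apply: integrableS (int _ mf fM).
- by apply: integrableS (int _ mg gM).
Qed.

Section exit.
Context {R : realType} {n : nat}.
Variable Omega : set 'rV[R]_n.
Hypothesis dOmega : domain Omega.
Local Notation X := 'rV[R]_n.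
Local Notation W := (game_sequence R n).

Definition inside k : set (history R n k) :=
  [set h | forall i, Omega (tnth h.1 i)].

Definition running k : set W := (@history_of R n k) @^-1` (@inside k).

Lemma measurable_inside k : measurable (@inside k).
Proof.
rewrite (_ : @inside k = \bigcap_(i in [set: 'I_k.+1])
    ((fun h : history R n k => tnth h.1 i) @^-1` Omega)).
  apply: fin_bigcap_measurable => // i _; rewrite -[X in measurable X]setTI.
  apply: (measurableT_comp (measurable_tnth i) measurable_fst) => //.
  exact: measurable_domain.
by apply/seteqP; split => h hO i; [move=> _; exact: hO|exact: hO].
Qed.

Lemma inside_current k (h : history R n k) : inside h -> Omega (current h).
Proof. exact. Qed.

Lemma measurable_running k : measurable (running k).
Proof.
by rewrite -[X in measurable X]setTI; apply: measurable_history_of => //; exact: measurable_inside.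
Qed.

Lemma runningP k (w : W) : running k w <-> forall i, (i <= k)%N -> Omega (w i).1.
Proof.
split=> [rw i ik|Ow i]; last by rewrite tnth_mktuple; apply: Ow; rewrite -ltnS.
by have := rw (inord i); rewrite tnth_mktuple inordK.
Qed.

Lemma running_dec k (w : W) : running k.+1 w -> running k w.
Proof. by move/runningP => h; apply/runningP => i ik; apply: h; exact: leqW. Qed.

Lemma running_last k (w : W) : running k w -> Omega (w k).1.
Proof. by move/runningP; exact. Qed.

(** The value of [v] at the position at time [k] of a token that stops as soon as
it has left [Omega]. *)
Fixpoint stopped (v : X -> R) k (w : W) : R :=
  match k with
  | 0 => v (w 0%N).1
  | j.+1 => if w \in running j then v (w j.+1).1 else stopped v j w
  end.

Lemma measurable_stopped v k : measurable_fun setT v -> measurable_fun setT (stopped v k).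
Proof.
move=> mv; have mvk j : measurable_fun setT (fun w : W => v (w j).1).
  exact: (measurableT_comp mv (measurable_game_position j)).
elim: k => [|k IH] /=; first exact: mvk.
apply: measurable_fun_ifT => //; apply: (measurable_fun_bool true).
rewrite setTI (_ : _ @^-1` _ = running k); first exact: measurable_running.
by apply/seteqP; split => w; [move=> hw; exact: set_mem|move=> hw; exact: mem_set hw].
Qed.

Lemma stopped_norm v (M : R) k w : (forall x, `|v x| <= M) -> `|stopped v k w| <= M.
Proof. by move=> vM; elim: k => //= k IH; case: ifP. Qed.

Lemma stopped_running v k w : running k w -> stopped v k w = v (w k).1.
Proof. by case: k => //= k /running_dec/mem_set ->. Qed.

Lemma stopped_exit v j k w : (forall i, (i < j)%N -> Omega (w i).1) ->
  ~ Omega (w j).1 -> (j <= k)%N -> stopped v k w = v (w j).1.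
Proof.
move=> Oj nOj; elim: k => [|k IH]; first by rewrite leqn0 => /eqP ->.
rewrite leq_eqVlt => /predU1P[jk|].
  by rewrite jk /= mem_set//; apply/runningP => i ik; apply: Oj; rewrite jk ltnS.
rewrite ltnS => jk; rewrite /= memNset ?IH// => /runningP/(_ j jk).
exact: nOj.
Qed.

End exit.

Section payoff.
Context {R : realType} {n : nat}.
Variables (Omega : set 'rV[R]_n) (eps : R) (F : 'rV[R]_n -> R).
Hypothesis dOmega : domain Omega.
Hypothesis mF : measurable_fun (boundary_strip Omega eps) F.
Local Notation X := 'rV[R]_n.
Local Notation W := (game_sequence R n).
Local Notation Gamma := (boundary_strip Omega eps).

Lemma payoff_exit (w : W) j : (forall i, (i < j)%N -> Omega (w i).1) ->
  Gamma (w j).1 -> payoff Omega eps F w = F (w j).1.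
Proof.
move=> Oj Gj; rewrite /payoff; case: pselect => [ends|]; last first.
  by case; exists j; exact/asboolP.
case: ex_minnP => i /asboolP Gi imin; suff -> : i = j by [].
apply/eqP; rewrite eqn_leq imin/=; last exact/asboolP.
by rewrite leqNgt; apply/negP => /Oj Oi; case: Gi.
Qed.

Lemma payoff_norm (M : R) w : 0 <= M -> (forall x, Gamma x -> `|F x| <= M) ->
  `|payoff Omega eps F w| <= M.
Proof.
move=> M0 FM; rewrite /payoff; case: pselect => [ends|_]; last by rewrite normr0.
by case: ex_minnP => j /asboolP Gj _; exact: FM.
Qed.

Lemma payoffN w : payoff Omega eps (fun x => - F x) w = - payoff Omega eps F w.
Proof. by rewrite /payoff; case: pselect => // _; rewrite oppr0. Qed.

Lemma measurable_payoff : measurable_fun setT (payoff Omega eps F : W -> R).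
Proof.
have mG : measurable Gamma by exact: measurable_boundary_strip.
pose E j := [set w : W | Gamma (w j).1].
have mE j : measurable (E j).
  by rewrite -[X in measurable X]setTI; exact: measurable_game_position.
pose never := ~` (\bigcup_j E j).
have mnever : measurable never by apply: measurableC; exact: bigcupT_measurable.
pose first_hit j := E j `\` \big[setU/set0]_(i < j) E i.
have mfirst j : measurable (first_hit j).
  by apply: measurableD => //; exact: bigsetU_measurable.
move=> _ B mB; rewrite setTI.
rewrite (_ : _ @^-1` B = (never `&` [set _ | B 0]) `|`
  \bigcup_j (first_hit j `&` [set w : W | B ((F \_ Gamma) (w j).1)])).
  apply: measurableU.
    apply: measurableI => //; have [B0|B0] := pselect (B 0).
      by rewrite (_ : [set _ | _] = setT)//; apply/seteqP; split.
    by rewrite (_ : [set _ | _] = set0)//; apply/seteqP; split.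
  apply: bigcupT_measurable => j; apply: measurableI => //.
  rewrite -[X in measurable X]setTI.
  exact: (measurableT_comp ((measurable_restrictT F mG).1 mF) (measurable_game_position j)).
have hitE j (w : W) : first_hit j w -> payoff Omega eps F w = (F \_ Gamma) (w j).1.
  move=> [Ej nEj]; rewrite patchE (mem_set (Ej : Gamma (w j).1)) /payoff.
  case: pselect => [ends|]; last by case; exists j; exact/asboolP.
  case: ex_minnP => i /asboolP Gi imin; suff -> : i = j by [].
  apply/eqP; rewrite eqn_leq imin/=; last exact/asboolP.
  rewrite leqNgt; apply/negP => ij; apply: nEj.
  by rewrite -bigcup_mkord; exists i.
apply/seteqP; split => w /=.
  move=> Bw; have [[j0 _ Ej0]|nE] := pselect ((\bigcup_j E j) w); last first.
    left; split => //; move: Bw; rewrite /payoff; case: pselect => // ends.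
    by have [j /asboolP Ej] := ends; case: nE; exists j.
  right; have ends : exists j, `[< E j w >] by exists j0; exact/asboolP.
  have [j /asboolP Ej jmin] := ex_minnP ends; exists j => //.
  have hit : first_hit j w.
    split=> //; rewrite -bigcup_mkord => -[i /= ij /asboolP/jmin].
    by rewrite leqNgt ij.
  by split=> //=; rewrite -hitE.
case=> [[nE B0]|[j _ [hit Bj]]]; last by rewrite (hitE j).
rewrite /payoff; case: pselect => // ends.
by have [j /asboolP Ej] := ends; case: nE; exists j.
Qed.

End payoff.

(** * Expected payoff of a pair of strategies *)

Section game_estimates.
Context {R : realType} {n : nat}.
Variables (Omega : set 'rV[R]_n) (eps alpha beta : R).
Hypotheses (n_gt0 : (0 < n)%N) (eps_gt0 : 0 < eps).
Hypothesis dOmega : domain Omega.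
Hypotheses (alpha_gt0 : 0 < alpha) (beta_gt0 : 0 < beta)
  (alphaDbeta : alpha + beta = 1).
Variables S1 S2 : strategy R n.
Arguments S1 : clear implicits.
Arguments S2 : clear implicits.
Hypotheses (mS1 : forall k, measurable_fun setT (S1 k))
  (mS2 : forall k, measurable_fun setT (S2 k)).
Hypotheses (legal1 : forall k h, eball (current h) eps (S1 k h))
  (legal2 : forall k h, eball (current h) eps (S2 k h)).
Variables (x0 : 'rV[R]_n) (P : probability (game_sequence R n) R).
Hypothesis x0_in : enlarged Omega eps x0.
Hypothesis PE : is_game_law Omega eps alpha beta x0 S1 S2 P.

Local Notation X := 'rV[R]_n.
Local Notation W := (game_sequence R n).
Local Notation running := (running Omega).
Local Notation stopped := (stopped Omega).
Local Notation round_mean := (round_mean eps alpha beta S1 S2).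

Let prob_fin (A : set W) : measurable A -> (P A < +oo)%E.
Proof. by move=> mA; rewrite (le_lt_trans (probability_le1 P mA))// ltry. Qed.

Let integrable_bounded (A : set W) (f : W -> R) (M : R) : measurable A ->
  measurable_fun setT f -> (forall w, `|f w| <= M) -> P.-integrable A (EFin \o f).
Proof.
move=> mA mf fM; apply: (@finite_bounded_integrable _ _ _ _ _ _ M) => //.
  exact: prob_fin.
exact: measurable_funTS.
Qed.

Let integral_split (A : set W) (f : W -> R) (M : R) : measurable A ->
  measurable_fun setT f -> (forall w, `|f w| <= M) ->
  \int[P]_w f w = \int[P]_(w in A) f w + \int[P]_(w in ~` A) f w.
Proof.
move=> mA mf fM; rewrite -Rintegral_setU ?setUv//.
- exact: measurableC.
- exact: integrable_bounded fM.
- by apply/disj_set2P; rewrite setICr.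
Qed.

Let measurable_start : measurable [set w : W | (w 0%N).1 = x0].
Proof.
rewrite (_ : [set w | _] = (fun w : W => (w 0%N).1) @^-1` [set x0])//.
rewrite -[X in measurable X]setTI; apply: measurable_game_position => //.
exact: measurable_set1_rV.
Qed.

Let cur_history k (w : W) : current (history_of k w) = (w k).1.
Proof. by rewrite /current tnth_mktuple. Qed.

Let p k := fine (P (running k)).

(** Between the times [k] and [k.+1] the stopped value changes only on
[running k], and there its conditional mean increases by at least [c]. *)
Lemma stopped_drift (v : X -> R) (M c : R) k : measurable_fun setT v ->
  (forall x, `|v x| <= M) ->
  (forall k (h : history R n k), Omega (current h) ->
    v (current h) + c <= round_mean v h) ->
  v x0 + c * (\sum_(j < k) p j) <= \int[P]_w stopped v k w.
Proof.
move=> mv vM drift; elim: k => [|k IH].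
  rewrite big_ord0 mulr0 addr0.
  apply: (@le_trans _ _ (\int[P]_w (cst (v x0) w))).
    by rewrite (Rintegral_probability_cst P).
  apply: (le_Rintegral_event (M := M) measurable_start PE.1) => //.
  - exact: (measurable_stopped dOmega 0 mv).
  - by move=> w; exact: vM.
  - by move=> w; exact: vM.
  - by move=> w /= ->.
have mr := measurable_running dOmega k.
have mst j := measurable_stopped dOmega j mv.
have sM j w := stopped_norm Omega j w vM.
have mvk j : measurable_fun setT (fun w : W => v (w j).1).
  exact: (measurableT_comp mv (measurable_game_position j)).
rewrite big_ord_recr/= mulrDr addrA.
apply: (@le_trans _ _ (\int[P]_w stopped v k w + c * p k)); first by rewrite lerD2r.
rewrite (integral_split mr (mst k) (sM k)) (integral_split mr (mst k.+1) (sM k.+1)).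
rewrite addrAC lerD//; last first.
  rewrite le_eqVlt; apply/orP; left; apply/eqP; apply: eq_Rintegral => w.
  by rewrite inE /= => nr; rewrite memNset.
have -> : \int[P]_(w in running k) stopped v k.+1 w = \int[P]_(w in running k) v (w k.+1).1.
  by apply: eq_Rintegral => w /= ->.
have := expected_round n_gt0 eps_gt0 dOmega alpha_gt0 beta_gt0 alphaDbeta mS1 mS2 PE
  (measurable_inside dOmega (k := k)) (@inside_current _ _ _ k) mv vM.
rewrite -/(running k) => ->.
have -> : c * p k = \int[P]_(w in running k) c by rewrite Rintegral_cst.
rewrite -RintegralD//; last 2 first.
- exact: integrable_bounded (sM k).
- by apply: (@integrable_bounded _ (cst c) `|c|).
apply: le_Rintegral => //.
- apply: (@integrable_bounded _ _ (M + `|c|)) => //; first exact: measurable_funD.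
  by move=> w; rewrite (le_trans (ler_normD _ _))// lerD.
- apply: (@integrable_bounded _ _ M) => //.
    apply: (measurableT_comp (measurable_round_mean _ _ n_gt0 eps_gt0 mS1 mS2 mv vM)).
    exact: measurable_history_of.
  by move=> w; apply: round_mean_norm.
move=> w rw; rewrite (stopped_running _ rw) -cur_history; apply: drift.
by rewrite cur_history; exact: running_last rw.
Qed.

Definition regular : set W := [set w | (w 0%N).1 = x0] `&`
  \bigcap_k ~` (running k `&` [set w | ~ enlarged Omega eps (w k.+1).1]).

Let E (x : X) : R := \1_(~` enlarged Omega eps) x.

Let mE : measurable_fun setT E.
Proof. by apply: measurable_indic; apply: measurableC; exact: measurable_enlarged. Qed.

Let E1 x : `|E x| <= 1.
Proof. by rewrite /E indicE; case: (_ \in _); rewrite ?normr1 ?normr0. Qed.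

Let E0 x y : Omega x -> eball x eps y -> E y = 0.
Proof.
by move=> Ox xy; rewrite /E indicE memNset// => /(_ (eball_sub_enlarged dOmega Ox xy)).
Qed.

Let measurable_outside k : measurable [set w : W | ~ enlarged Omega eps (w k.+1).1].
Proof.
have mout : measurable (~` enlarged Omega eps).
  by apply: measurableC; exact: measurable_enlarged.
by have := @measurable_game_position R n k.+1 measurableT _ mout; rewrite setTI.
Qed.

Let measurable_escape k :
  measurable (running k `&` [set w : W | ~ enlarged Omega eps (w k.+1).1]).
Proof.
by apply: measurableI => //; exact: measurable_running.
Qed.

Lemma escape0 k :
  P (running k `&` [set w : W | ~ enlarged Omega eps (w k.+1).1]) = 0%E.
Proof.
have := expected_round n_gt0 eps_gt0 dOmega alpha_gt0 beta_gt0 alphaDbeta mS1 mS2 PE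
  (measurable_inside dOmega (k := k)) (@inside_current _ _ _ k) mE E1.
rewrite -/(running k) (_ : \int[P]_(w in _) round_mean E _ = 0); last first.
  rewrite (@eq_Rintegral _ _ _ _ _ (cst 0)) ?Rintegral_cst ?mul0r//; first exact: measurable_running.
  move=> w /set_mem rw; have Ow : Omega (current (history_of k w)).
    by rewrite cur_history; exact: running_last rw.
  rewrite /round_mean (E0 Ow (legal1 _)) (E0 Ow (legal2 _)) /ball_average.
  rewrite (@eq_Rintegral _ _ _ _ _ (cst 0)) ?Rintegral_cst; first by rewrite !mul0r !mulr0 !addr0.
    exact: measurable_eball.
  by move=> y /set_mem wy; exact: E0 wy.
rewrite /Rintegral => E00.
have mEk : measurable_fun setT (fun w : W => (E (w k.+1).1)%:E).
  by apply/measurable_EFinP; exact: (measurableT_comp mE (measurable_game_position k.+1)).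
have : (\int[P]_(w in running k) (E (w k.+1).1)%:E)%E = 0%E.
  rewrite -[LHS]fineK ?E00//; apply: integrable_fin_num.
    exact: measurable_running.
  apply: (@integrable_bounded _ (fun w : W => E (w k.+1).1) 1) => //.
    exact: measurable_running.
  exact: (measurableT_comp mE (measurable_game_position k.+1)).
rewrite (_ : (fun w : W => _) = fun w : W =>
  (\1_[set w : W | ~ enlarged Omega eps (w k.+1).1] w)%:E); last first.
  by apply/funext => w; rewrite /E !indicE.
by rewrite integral_indic; [rewrite setIC|exact: measurable_running|exact: measurable_outside].
Qed.

Lemma measurable_regular : measurable regular.
Proof.
apply: measurableI; first exact: measurable_start.
by apply: bigcapT_measurable => k; apply: measurableC; exact: measurable_escape.
Qed.

(** Every move from [Omega] has length less than [eps], and so cannot jump over the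
strip. *)
Lemma regular1 : P regular = 1%E.
Proof.
have N : P.-negligible (~` regular).
  rewrite /regular setCI setC_bigcap; apply: negligibleU.
    exists (~` [set w : W | (w 0%N).1 = x0]); split => //.
      by apply: measurableC; exact: measurable_start.
    by have := probability_setC P measurable_start; rewrite PE.1 subee.
  apply: negligible_bigcup => k; rewrite setCK.
  by apply/negligibleP; [exact: measurable_escape|exact: escape0].
have := probability_setC P (measurableC measurable_regular).
rewrite setCK => ->; rewrite (_ : P (~` regular) = 0%E) ?sube0//.
by apply: measure_negligible => //; apply: measurableC; exact: measurable_regular.
Qed.

Variables (F v : X -> R) (M : R).
Hypotheses (mF : measurable_fun (boundary_strip Omega eps) F)
  (mv : measurable_fun setT v) (vM : forall x, `|v x| <= M).
Hypothesis vF : forall x, boundary_strip Omega eps x -> v x = F x.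

Let M_ge0 : 0 <= M. Proof. exact: le_trans (normr_ge0 _) (vM point). Qed.

Let FM x : boundary_strip Omega eps x -> `|F x| <= M.
Proof. by move=> /vF <-. Qed.

Lemma payoff_stopped k w : regular w -> ~ running k w ->
  payoff Omega eps F w = stopped v k w.
Proof.
move=> [w0 reg] nrw.
have ex : exists i, (i <= k)%N && `[< ~ Omega (w i).1 >].
  apply: contrapT => nex; apply: nrw; apply/runningP => i ik.
  by apply: contrapT => nO; apply: nex; exists i; rewrite ik; exact/asboolP.
have [j /andP[jk /asboolP nOj] jmin] := ex_minnP ex.
have Oj i : (i < j)%N -> Omega (w i).1.
  move=> ij; apply: contrapT => nO.
  have /jmin : (i <= k)%N && `[< ~ Omega (w i).1 >].
    by rewrite (ltnW (leq_trans ij jk)); exact/asboolP.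
  by rewrite leqNgt ij.
have Gj : boundary_strip Omega eps (w j).1.
  suff : enlarged Omega eps (w j).1 by case.
  case: j {jk jmin nOj} Oj => [|j] Oj; first by rewrite w0.
  apply: contrapT => out; apply: (reg j I); split => //.
  by apply/runningP => i ij; apply: Oj; rewrite ltnS.
by rewrite (payoff_exit F Oj Gj) -vF// (stopped_exit v Oj nOj jk).
Qed.

(** The payoff differs from the stopped value only while the game is running, and
then by at most [2 * M]. *)
Lemma expected_payoff_stopped k :
  \int[P]_w stopped v k w - 2 * M * p k <= \int[P]_w payoff Omega eps F w.
Proof.
have mr := measurable_running dOmega k.
have mst := measurable_stopped dOmega k mv.
have sM w := stopped_norm Omega k w vM.
have m1 : measurable_fun setT (\1_(running k) : W -> R) by exact: measurable_indic.
have b1 w : `|\1_(running k) w : R| <= 1.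
  by rewrite indicE; case: (_ \in _); rewrite ?normr1 ?normr0.
have iM w : `|2 * M * \1_(running k) w| <= 2 * M.
  by rewrite normrM ger0_norm ?mulr_ge0// ler_piMr// mulr_ge0.
have m2 : measurable_fun setT (fun w : W => 2 * M * \1_(running k) w).
  exact: measurable_funM.
have -> : 2 * M * p k = \int[P]_w (2 * M * \1_(running k) w).
  rewrite RintegralZl//; last by exact: integrable_bounded b1.
  by rewrite /p /Rintegral integral_indic// setIT.
rewrite -RintegralB//; last 2 first.
- exact: integrable_bounded sM.
- exact: integrable_bounded iM.
apply: (le_Rintegral_event (M := M + 2 * M) measurable_regular regular1).
- exact: measurable_funB.
- exact: measurable_payoff.
- by move=> w; rewrite (le_trans (ler_normB _ _))// lerD.
- move=> w; rewrite (le_trans (payoff_norm w M_ge0 FM))// lerDl mulr_ge0//.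
move=> w rw; have [rkw|nrkw] := pselect (running k w); last first.
  by rewrite indicE memNset// mulr0 subr0 (payoff_stopped rw nrkw).
rewrite indicE mem_set// mulr1.
have := payoff_norm w M_ge0 FM; have := sM w.
by rewrite !ler_norml => /andP[_ ?] /andP[? _]; lra.
Qed.

(** The expected duration of the game is bounded, since [g] gains at least [m] on
average in each round and never exceeds [K]. *)
Lemma sum_running (g : X -> R) (K m : R) k : measurable_fun setT g ->
  (forall x, 0 <= g x <= K) -> 0 < m -> (forall x, Omega x -> m <= g x) ->
  (forall x, Omega x -> 2 * g x <= beta * ball_average eps g x) ->
  \sum_(j < k) p j <= K / m.
Proof.
move=> mg gK m0 gm gavg; rewrite ler_pdivlMr// mulrC.
have gN x : `|g x| <= K by have /andP[g0 ?] := gK x; rewrite ger0_norm.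
have a2 : 0 <= alpha / 2 by rewrite divr_ge0// ltW.
have := @stopped_drift g K m k mg gN.
have drift j (h : history R n j) : Omega (current h) -> g (current h) + m <= round_mean g h.
  move=> Oh; have := gavg _ Oh; have := gm _ Oh; rewrite /round_mean.
  have /andP[g1 _] := gK (S1 j h); have /andP[g2 _] := gK (S2 j h).
  by have := mulr_ge0 a2 g1; have := mulr_ge0 a2 g2; lra.
move=> /(_ drift) h.
have : \int[P]_w stopped g k w <= K.
  rewrite -(Rintegral_probability_cst P K); apply: (le_Rintegral_event (M := K) measurableT) => //.
  - exact: probability_setT.
  - exact: measurable_stopped.
  - by move=> w; exact: stopped_norm.
  - by move=> w; rewrite /= ger0_norm// (le_trans _ (gN point)).
  - by move=> w _; rewrite (le_trans (ler_norm _))//; exact: stopped_norm.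
by have /andP[g0 _] := gK x0; lra.
Qed.

(** The stopped value loses at most [eta] on average in each round that is played.
As the probabilities [p k] have bounded sums, one of them is so small that
stopping at the time [k] hardly changes the payoff. *)
Lemma expected_payoff_ge (g : X -> R) (K m eta : R) : measurable_fun setT g ->
  (forall x, 0 <= g x <= K) -> 0 < m -> (forall x, Omega x -> m <= g x) ->
  (forall x, Omega x -> 2 * g x <= beta * ball_average eps g x) ->
  0 <= eta ->
  (forall k (h : history R n k), Omega (current h) ->
    v (current h) - eta <= round_mean v h) ->
  v x0 - eta * (K / m) <= \int[P]_w payoff Omega eps F w.
Proof.
move=> mg gK m0 gm gavg eta0 drift.
have sumC k := sum_running k mg gK m0 gm gavg.
have p_ge0 k : 0 <= p k by rewrite fine_ge0.
apply/ler_addgt0Pr => e e0.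
(* adding 1 allows for [M = 0] *)
pose e' := e / (2 * M + 1).
have M1 : 0 < 2 * M + 1 by rewrite ltr_wpDl// mulr_ge0.
have e'0 : 0 < e' by rewrite divr_gt0.
have [k pk] : exists k, p k <= e'.
  apply: contrapT => /forallNP np.
  have big k : k%:R * e' <= \sum_(j < k) p j.
    rewrite -[k in k%:R]card_ord mulr_natl -sumr_const ler_sum// => j _.
    by rewrite ltW// ltNge; apply/negP; exact: np.
  have := le_trans (big (Num.truncn (K / m / e')).+1) (sumC _).
  by rewrite -ler_pdivlMr// leNgt truncnS_gt.
have h1 := @stopped_drift v M (- eta) k mv vM drift.
have h2 := expected_payoff_stopped k.
have h3 : 2 * M * p k <= e.
  apply: (@le_trans _ _ (2 * M * e')); first by rewrite ler_wpM2l// mulr_ge0.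
  rewrite /e' mulrA ler_pdivrMr// mulrC ler_wpM2l ?(ltW e0)//; lra.
have h4 : eta * \sum_(j < k) p j <= eta * (K / m) by rewrite ler_wpM2l.
by lra.
Qed.

End game_estimates.

(** * The values of the game *)

Section values.
Context {R : realType} {n : nat}.
Variables (Omega : set 'rV[R]_n) (eps alpha beta : R) (F : 'rV[R]_n -> R).
Hypotheses (n_gt0 : (0 < n)%N) (eps_gt0 : 0 < eps).
Hypotheses (dOmega : domain Omega) (bOmega : bounded_set Omega).
Hypotheses (alpha_gt0 : 0 < alpha) (beta_gt0 : 0 < beta)
  (alphaDbeta : alpha + beta = 1).
Hypothesis mF : measurable_fun (boundary_strip Omega eps) F.
Local Notation X := 'rV[R]_n.

Lemma strategies_measurable a (S : strategy R n) k :
  strategies eps a S -> measurable_fun setT (S k).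
Proof.
move=> [+ _]; case: a => /= [[g gP]|[g gP]|//].
- have [mg gE] := gP k; rewrite (_ : S k = g k \o @current R n k).
    exact: (measurableT_comp mg (@measurable_current _ _ k)).
  by apply/funext => h; exact: gE.
- have [mg gE] := gP k; rewrite (_ : S k = g k \o fst).
    exact: (measurableT_comp mg measurable_fst).
  by apply/funext => h; exact: gE.
Qed.

Definition stationary (s : X -> X) : strategy R n := fun k h => s (current h).

(** A Borel rule that looks only at the current position is allowed whatever
the information, so one stationary strategy serves the three alternatives. *)
Lemma stationary_strategy a (s : X -> X) : measurable_fun setT s ->
  (forall x, eball x eps (s x)) -> strategies eps a (stationary s).
Proof.
move=> ms sB; split; last by move=> k h; exact: sB.
case: a => /=.
- by exists (fun=> s).
- exists (fun k t => s (tnth t ord_max)) => k; split => //.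
  exact: (measurableT_comp ms (measurable_tnth _)).
- by move=> k; exact: (measurableT_comp ms (@measurable_current _ _ k)).
Qed.

Section solution.
Variables (v : X -> R) (M : R).
Hypotheses (mv : measurable_fun setT v) (vM : forall x, `|v x| <= M).
Hypothesis vF : forall x, boundary_strip Omega eps x -> v x = F x.
Hypothesis vT : forall x, Omega x -> v x = tug_average eps alpha beta v x.

Local Notation E := (expected_payoff Omega eps alpha beta F).

Let FM x : boundary_strip Omega eps x -> `|F x| <= M.
Proof. by move=> /vF <-. Qed.

Let integrable_payoff (P : probability (game_sequence R n) R) :
  P.-integrable setT (EFin \o payoff Omega eps F).
Proof.
apply: (@finite_bounded_integrable _ _ _ _ _ _ M) => //.
- by rewrite (le_lt_trans (probability_le1 _ measurableT))// ltry.
- exact: measurable_payoff.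
- move=> w _; apply: payoff_norm => //.
  exact: le_trans (normr_ge0 _) (vM point).
Qed.

Lemma expected_payoffE x S1 S2 : E x S1 S2 =
  (\int[game_law Omega eps alpha beta x S1 S2]_w payoff Omega eps F w)%:E.
Proof.
rewrite /expected_payoff unlock /Rintegral fineK//.
by apply: integrable_fin_num => //; exact: integrable_payoff.
Qed.

Let alpha_le1 : alpha <= 1.
Proof. by rewrite -alphaDbeta lerDl ltW. Qed.

(** The player who follows an almost optimal rule for [v] loses at most [eta] per
round on average, and the expected number of rounds is bounded by some [C]. The
claim about Player II is the one about Player I for [- v] and [- F]. *)
Lemma values_near_solution : exists C : R, 0 <= C /\
  forall a x (eta : R), enlarged Omega eps x -> 0 < eta ->
  (exists2 S1, strategies eps a S1 & forall S2, strategies eps a S2 ->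
    ((v x - eta * C)%:E <= E x S1 S2)%E) /\
  (exists2 S2, strategies eps a S2 & forall S1, strategies eps a S1 ->
    (E x S1 S2 <= (v x + eta * C)%:E)%E).
Proof.
have [g [K [m [mg gK m0 gm gavg]]]] :=
  exists_potential n_gt0 eps_gt0 dOmega bOmega beta_gt0.
have K0 : 0 <= K by have /andP[h1 h2] := gK point; exact: le_trans h2.
exists (K / m); split; first by rewrite divr_ge0// ltW.
move=> a x eta ex eta0.
have a2 : 0 < alpha / 2 by rewrite divr_gt0.
split.
  have [s [ms sB sopt]] := exists_almost_optimal_move eps_gt0 eta0 vM.
  exists (stationary s); first exact: stationary_strategy.
  move=> S2 hS2; rewrite expected_payoffE lee_fin.
  have legal1 k h : eball (current h) eps (stationary s (k := k) h) by exact: sB.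
  have mS1 k : measurable_fun setT (@stationary s k).
    exact: (strategies_measurable (stationary_strategy a ms sB)).
  have mS2 k : measurable_fun setT (S2 k) by exact: (strategies_measurable hS2).
  have law := game_law_is_law n_gt0 eps_gt0 dOmega alpha_gt0 beta_gt0 alphaDbeta
    mS1 mS2 x.
  apply: (expected_payoff_ge n_gt0 eps_gt0 dOmega alpha_gt0 beta_gt0 alphaDbeta
    mS1 mS2 legal1 hS2.2 ex law mF mv vM vF mg gK m0 gm gavg (ltW eta0)).
  move=> k h Oh; rewrite vT// /tug_average /round_mean.
  have h1 := ler_wpM2l (ltW a2) (ltW (sopt (current h))).
  have h2 := ler_wpM2l (ltW a2) (ball_inf_le vM (hS2.2 k h)).
  have h3 : alpha / 2 * eta <= eta.
    by rewrite ler_piMl ?(ltW eta0)//; move: alpha_le1; lra.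
  by move: h1; rewrite mulrBr /stationary; lra.
have vNM y : `|- v y| <= M by rewrite normrN.
have [s [ms sB sopt]] := exists_almost_optimal_move eps_gt0 eta0 vNM.
exists (stationary s); first exact: stationary_strategy.
move=> S1 hS1; rewrite expected_payoffE lee_fin.
have legal2 k h : eball (current h) eps (stationary s (k := k) h) by exact: sB.
have mS2 k : measurable_fun setT (@stationary s k).
  exact: (strategies_measurable (stationary_strategy a ms sB)).
have mS1 k : measurable_fun setT (S1 k) by exact: (strategies_measurable hS1).
have law := game_law_is_law n_gt0 eps_gt0 dOmega alpha_gt0 beta_gt0 alphaDbeta
  mS1 mS2 x.
have mNF : measurable_fun (boundary_strip Omega eps) (fun x => - F x).
  exact: measurable_funN.
have mNv : measurable_fun setT (fun x => - v x) by exact: measurable_funN.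
have vNF y : boundary_strip Omega eps y -> - v y = - F y by move=> /vF ->.
have := expected_payoff_ge n_gt0 eps_gt0 dOmega alpha_gt0 beta_gt0 alphaDbeta
  mS1 mS2 hS1.2 legal2 ex law mNF mNv vNM vNF mg gK m0 gm gavg (ltW eta0).
have drift k (h : history R n k) : Omega (current h) ->
    - v (current h) - eta <=
    round_mean eps alpha beta S1 (stationary s) (fun x => - v x) h.
  move=> Oh; rewrite vT// /tug_average /round_mean (ball_averageN eps_gt0 _ mv vM).
  have h1 := ler_wpM2l (ltW a2) (ltW (sopt (current h))).
  have h2 := ler_wpM2l (ltW a2) (le_ball_sup vM (hS1.2 k h)).
  have h3 : alpha / 2 * eta <= eta.
    by rewrite ler_piMl ?(ltW eta0)//; move: alpha_le1; lra.
  by move: h1; rewrite ball_supN mulrBr mulrN /stationary mulrN; lra.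
move=> /(_ drift); rewrite (_ : \int[_]_w _ = - \int[game_law Omega eps alpha beta x S1 (stationary s)]_w payoff Omega eps F w).
  by lra.
rewrite -mulN1r -RintegralZl//.
  by apply: eq_Rintegral => w _; rewrite payoffN mulN1r.
exact: integrable_payoff.
Qed.

Local Notation value_I := (value_I Omega eps alpha beta F).
Local Notation value_II := (value_II Omega eps alpha beta F).

Lemma value_I_le_II a x : (value_I a x <= value_II a x)%E.
Proof.
apply: ge_ereal_sup => _ [S1 hS1 <-]; apply: le_ereal_inf_tmp => _ [S2 hS2 <-].
apply: (@le_trans _ _ (E x S1 S2)).
  by apply: ereal_inf_lbound; exists S2.
by apply: ereal_sup_ubound; exists S1.
Qed.

Lemma values_eq_solution a x : enlarged Omega eps x ->
  value_I a x = (v x)%:E /\ value_II a x = (v x)%:E.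
Proof.
move=> ex; have [C [C0 near_opt]] := values_near_solution.
have C1 : 0 < C + 1 by rewrite ltr_wpDl.
have eC (e : R) : 0 < e -> 0 < e / (C + 1) /\ e / (C + 1) * C <= e.
  move=> e0; split; first by rewrite divr_gt0.
  by rewrite mulrAC ler_pdivrMr// ler_wpM2l ?(ltW e0)//; lra.
have lower : ((v x)%:E <= value_I a x)%E.
  apply/lee_addgt0Pr => e e0; have [eta0 etaC] := eC _ e0.
  have [[S1 hS1 h] _] := near_opt a x _ ex eta0.
  rewrite -leeBlDr//; apply: (@le_trans _ _ (ereal_inf [set E x S1 S2 | S2 in strategies eps a])).
    apply: le_ereal_inf_tmp => _ [S2 hS2 <-]; apply: le_trans (h S2 hS2).
    by rewrite -EFinB lee_fin lerB.
  by apply: ereal_sup_ubound; exists S1.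
have upper : (value_II a x <= (v x)%:E)%E.
  apply/lee_addgt0Pr => e e0; have [eta0 etaC] := eC _ e0.
  have [_ [S2 hS2 h]] := near_opt a x _ ex eta0.
  apply: (@le_trans _ _ (ereal_sup [set E x S1 S2 | S1 in strategies eps a])).
    by apply: ereal_inf_lbound; exists S2.
  apply: ge_ereal_sup => _ [S1 hS1 <-]; apply: le_trans (h S1 hS1) _.
  by rewrite -EFinD lee_fin lerD2l.
have I_II := value_I_le_II a x.
by split; apply/eqP; rewrite eq_le ?lower ?upper ?andbT /=;
  [exact: le_trans upper|exact: le_trans I_II].
Qed.

End solution.

(** Solutions are compared through their restrictions to the enlarged domain,
which contains every ball that the equation involves. *)
Lemma dpp_values w a x : dpp_solution Omega eps alpha beta F w ->
  enlarged Omega eps x ->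
  value_I Omega eps alpha beta F a x = (w x)%:E /\
  value_II Omega eps alpha beta F a x = (w x)%:E.
Proof.
move=> [mw [M wM] wF wT] ex; pose En := enlarged Omega eps; pose v := w \_ En.
have mEn : measurable En by exact: measurable_enlarged.
have vE y : En y -> v y = w y by move=> ey; rewrite /v patchE mem_set.
have mv : measurable_fun setT v by exact: (measurable_restrictT w mEn).1.
have vM y : `|v y| <= `|M|.
  rewrite /v patchE; case: ifPn => [/set_mem/wM h|_]; last by rewrite normr0.
  exact: le_trans h (ler_norm _).
have vF y : boundary_strip Omega eps y -> v y = F y.
  by move=> Gy; rewrite vE; [exact: wF|left].
have vT y : Omega y -> v y = tug_average eps alpha beta v y.
  move=> Oy; have sub := eball_sub_enlarged (eps := eps) dOmega Oy.
  have im : v @` eball y eps = w @` eball y eps.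
    by apply/seteqP; split => _ [z yz <-]; exists z => //; rewrite vE//; exact: sub.
  rewrite vE; last by right.
  rewrite wT// /tug_average /ball_sup /ball_inf im /ball_average mulrA.
  congr (_ + _ + _ * _); apply: eq_Rintegral => z /set_mem yz.
  by rewrite vE//; exact: sub.
have := values_eq_solution mv vM vF vT a ex.
by rewrite vE.
Qed.

End values.

Theorem corollary3p3 (R : realType) (n : nat) (Omega : set 'rV[R]_n)
    (eps alpha beta : R) (F : 'rV[R]_n -> R) :
  (0 < n)%N ->
  domain Omega -> bounded_set Omega ->
  0 < eps -> 0 < alpha -> 0 < beta -> alpha + beta = 1 ->
  measurable_fun (boundary_strip Omega eps) F ->
  bounded_on (boundary_strip Omega eps) F ->
  exists u : 'rV[R]_n -> R,
    [/\ dpp_solution Omega eps alpha beta F u,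
        (forall v, dpp_solution Omega eps alpha beta F v ->
           forall x, enlarged Omega eps x -> v x = u x) &
        forall a : information,
          [/\ (forall x, enlarged Omega eps x ->
                 value_I Omega eps alpha beta F a x =
                 value_II Omega eps alpha beta F a x),
              measurable_fun (enlarged Omega eps)
                (value_I Omega eps alpha beta F a) &
              forall x, enlarged Omega eps x ->
                value_I Omega eps alpha beta F a x = (u x)%:E]].

Proof.
move=> n0 dO bO e0 a0 b0 ab mF [M FM].
have FM' x : boundary_strip Omega eps x -> `|F x| <= `|M|.
  by move=> /FM h; exact: le_trans h (ler_norm _).
have [u [mu uM uT]] := exists_fixed_point n0 e0 dO bO a0 b0 ab mF FM' (normr_ge0 M).
have u_sol : dpp_solution Omega eps alpha beta F u.
  split.
  - exact: measurable_funTS.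
  - by exists `|M| => x _.
  - by move=> x Gx; rewrite uT dpp_operator_strip.
  - move=> x Ox; rewrite {1}uT dpp_operator_in//.
    by rewrite /tug_average /ball_average mulrA.
have val w a x := @dpp_values _ _ _ _ _ _ _ n0 e0 dO bO a0 b0 ab mF w a x.
exists u; split => // [w w_sol x ex|a].
  (* every solution is the value of the game *)
  apply: EFin_inj.
  by rewrite -(val _ CurrentLocation _ w_sol ex).1 (val _ CurrentLocation _ u_sol ex).1.
have vI x : enlarged Omega eps x ->
    value_I Omega eps alpha beta F a x = (u x)%:E.
  by move=> ex; exact: (val _ a _ u_sol ex).1.
split => //.
- by move=> x ex; rewrite vI// (val _ a _ u_sol ex).2.
- apply: (@eq_measurable_fun _ _ _ _ _ (EFin \o u)) => [x /set_mem ex|].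
    by rewrite /= vI.
  by apply/measurable_EFinP; exact: measurable_funTS.
Qed.
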